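(* Let $X:\Omega\times\mathbb{R}^+\to\mathbb{R}$ be an optional process such that all trajectories of $X$ are regulated, $\Delta X_0=0$, and the set of jumps of each trajectory of $X$ is not finite. Then the function $$j_X:\Omega\times\big(\mathcal{B}(\mathbb{R}^+)\otimes\mathcal{B}(\mathbb{R})\big)\to\mathbb{Z}^+\cup\{+\infty\},\qquad(\omega,G)\mapsto\sum_{s>0}\mathbf{1}_G\big(s,\Delta X_s(\omega)\big)\,\mathbf{1}_{\{\Delta X\ne0\}}(\omega,s)$$ is an integer-valued random measure.
   Context: $(\Omega,\mathcal{F},\mathbf{F},\mathbb{P})$ is a filtered probability space whose filtration $\mathbf{F}=(\mathcal{F}_t)_{t\ge0}$ satisfies the usual conditions. $\mathbb{R}^+=[0,\infty)$, $\mathbb{Z}^+=\{0,1,2,\dots\}$. The optional $\sigma$-field $\mathcal{O}$ on $\Omega\times\mathbb{R}^+$ is generated by all càdlàg adapted processes, the predictable $\sigma$-field $\mathcal{P}$ by all left-continuous adapted processes; a process is optional if it is $\mathcal{O}$-measurable. A function $f:\mathbb{R}^+\to\mathbb{R}$ is regulated if it has (finite) right and left limits everywhere on $(0,\infty)$ and $f(0+)$ exists. $\Delta X_t:=X_{t+}-X_{t-}$ with the convention $X_{0-}:=X_{0+}$; $\{\Delta X\ne0\}:=\{(\omega,t)\in\Omega\times\mathbb{R}^+:\Delta X_t(\omega)\ne0\}$; the set of jumps of the trajectory of $\omega$ is $\{t>0:\Delta X_t(\omega)\ne0\}$. A random measure on $\mathbb{R}^+\times\mathbb{R}$ is a family $\mu=(\mu(\omega;\cdot):\omega\in\Omega)$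 of non-negative measures on $(\mathbb{R}^+\times\mathbb{R},\mathcal{B}(\mathbb{R}^+\times\mathbb{R}))$ with $\mu(\omega;\{0\}\times\mathbb{R})=0$ for all $\omega\in\Omega$. It is integer-valued if (i) $\mu(\omega;\{t\}\times\mathbb{R})\le1$ for all $\omega\in\Omega$, $t\geq 0$; (ii) $\mu(\cdot\,;G)$ takes values in $\mathbb{Z}^+\cup\{+\infty\}$ for every Borel $G$; (iii) $\mu$ is optional, i.e. for every non-negative $\mathcal{O}\otimes\mathcal{B}(\mathbb{R})$-measurable $W$ the process $(\omega,t)\mapsto\int_{[0,t]\times\mathbb{R}}W(\omega,s,x)\,\mu(\omega;d(s,x))$ is $\mathcal{O}$-measurable, and $\mathcal{P}\otimes\mathcal{B}(\mathbb{R})$-$\sigma$-finite, i.e. there is a countable partition $(A_n)$ of $\Omega\times\mathbb{R}^+\times\mathbb{R}$ into $\mathcal{P}\otimes\mathcal{B}(\mathbb{R})$-measurable sets with $\mathbb{E}\big[\int\mathbf{1}_{A_n}(\cdot,s,x)\,\mu(\cdot\,;d(s,x))\big]<\infty$ for each $n$. *)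

(* Defs.v *)
From HB Require Import structures.
From mathcomp Require Import all_boot all_order all_algebra.
From mathcomp Require Import all_classical all_reals all_analysis.
From mathcomp Require Import measurable_realfun.

Set Implicit Arguments.
Unset Strict Implicit.
Unset Printing Implicit Defensive.

Import Order.TTheory GRing.Theory Num.Theory.
Import numFieldTopology.Exports numFieldNormedType.Exports.

Local Open Scope classical_set_scope.
Local Open Scope ring_scope.

(* [0, +oo[ with the Borel sigma-algebra inherited from R, i.e. the trace of
   B(R); the measurable sets of Rplus R * R are then B(R^+) (x) B(R), which is
   also the Borel sigma-algebra of the product. *)
Definition Rplus (R : realType) : Type := {nonneg R}.

HB.instance Definition _ (R : realType) := Order.Total.copy (Rplus R) {nonneg R}.

Definition Rplus0 (R : realType) : Rplus R := 0%:nng.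

HB.instance Definition _ (R : realType) := isPointed.Build (Rplus R) (Rplus0 R).

Definition Rplus_val (R : realType) (t : Rplus R) : R := t%:num.

HB.instance Definition _ (R : realType) :=
  Measurable.copy (Rplus R) (g_sigma_algebra_preimageType (@Rplus_val R)).

Section paths.
Context {R : realType}.
Implicit Types (f : Rplus R -> R) (t : Rplus R).

(* Even extension of f to R: it agrees with f on [0, +oo[, and every one-sided
   limit used below only depends on the values of f on [0, +oo[. *)
Definition extend f (r : R) : R := f (`|r|%:nng : {nonneg R}).

Definition cvg_right f t := cvg (extend f r @[r --> (Rplus_val t)^'+]).
Definition cvg_left f t := cvg (extend f r @[r --> (Rplus_val t)^'-]).

Definition right_lim f t : R := lim (extend f r @[r --> (Rplus_val t)^'+]).

(* f(0-) := f(0+) *)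
Definition left_lim f t : R :=
  if t == Rplus0 R then right_lim f t
  else lim (extend f r @[r --> (Rplus_val t)^'-]).

Definition regulated f :=
  (forall t, (Rplus0 R < t)%O -> cvg_right f t /\ cvg_left f t) /\
  cvg_right f (Rplus0 R).

Definition cadlag f :=
  (forall t, extend f r @[r --> (Rplus_val t)^'+] --> f t) /\
  (forall t, (Rplus0 R < t)%O -> cvg_left f t).

Definition left_continuous f :=
  forall t, (Rplus0 R < t)%O -> extend f r @[r --> (Rplus_val t)^'-] --> f t.

Definition jump f t : R := right_lim f t - left_lim f t.

Definition jump_times f : set (Rplus R) :=
  [set t | (Rplus0 R < t)%O /\ jump f t != 0].

End paths.

Section processes.
Context {d : measure_display} {Omega : measurableType d} {R : realType}.
Implicit Types (P : probability Omega R) (F : Rplus R -> set_system Omega)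
  (X : Omega * Rplus R -> R).

Definition filtration F :=
  [/\ forall t, sigma_algebra [set: Omega] (F t),
      forall t, F t `<=` measurable &
      forall s t, (s <= t)%O -> F s `<=` F t].

(* As F 0 is contained in the ambient sigma-algebra, the second condition also
   entails that P is complete. *)
Definition usual_conditions P F :=
  (forall t, F t = \bigcap_(s in [set s | (t < s)%O]) F s) /\
  (forall N, P.-negligible N -> F (Rplus0 R) N).

Definition trajectory X (w : Omega) : Rplus R -> R := fun t => X (w, t).

Definition adapted F X :=
  forall t (B : set R), measurable B -> F t [set w | B (X (w, t))].

Definition optional_generator F : set_system (Omega * Rplus R) :=
  [set A | exists Y, [/\ adapted F Y, forall w, cadlag (trajectory Y w) &
     exists2 B : set R, measurable B & A = Y @^-1` B]].

Definition predictable_generator F : set_system (Omega * Rplus R) :=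
  [set A | exists Y, [/\ adapted F Y, forall w, left_continuous (trajectory Y w) &
     exists2 B : set R, measurable B & A = Y @^-1` B]].

(* Omega * R^+ equipped with the optional, resp. predictable, sigma-field. *)
Definition optionalType F := g_sigma_algebraType (optional_generator F).
Definition predictableType F := g_sigma_algebraType (predictable_generator F).

Definition optional_process F X :=
  measurable_fun [set: optionalType F] (X : optionalType F -> R).

Definition jump_set X : set (Omega * Rplus R) :=
  [set p | jump (trajectory X p.1) p.2 != 0].

Definition jump_measure X (w : Omega) (G : set (Rplus R * R)) : \bar R :=
  \esum_(s in [set s : Rplus R | (Rplus0 R < s)%O])
    (\1_G (s, jump (trajectory X w) s) * \1_(jump_set X) (w, s))%:E.

Implicit Types mu : Omega -> set (Rplus R * R) -> \bar R.

(* mu w is compared with a measure on measurable sets only; these are the only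
   sets that integration against mu w looks at. *)
Definition random_measure mu :=
  forall w,
    (exists m : {measure set (Rplus R * R)%type -> \bar R},
       forall G, measurable G -> mu w G = m G) /\
    mu w ([set Rplus0 R] `*` [set: R]) = 0%E.

Definition optional_measure F mu :=
  forall W : optionalType F * R -> \bar R,
    measurable_fun [set: (optionalType F * R)%type] W ->
    (forall y, (0 <= W y)%E) ->
    measurable_fun [set: optionalType F]
      (fun p : optionalType F =>
         \int[mu p.1]_(y in [set y | (y.1 <= p.2)%O]) W ((p.1, y.1), y.2))%E.

(* Members of the partition are allowed to be empty, so that finite partitions
   are covered. *)
Definition predictable_sigma_finite P F mu :=
  exists A : nat -> set (predictableType F * R),
    [/\ forall n, measurable (A n),
        trivIset setT A,
        \bigcup_n A n = setT &
        forall n,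
          (\int[P]_w \int[mu w]_y (\1_(A n) ((w, y.1), y.2))%:E < +oo)%E].

Definition integer_valued_random_measure P F mu :=
  [/\ random_measure mu,
      forall w t, (mu w ([set t] `*` [set: R]) <= 1)%E,
      forall w G, measurable G ->
        (exists n : nat, mu w G = n%:R%:E) \/ mu w G = +oo%E,
      optional_measure F mu &
      predictable_sigma_finite P F mu].

End processes.

(* Main.v *)
From HB Require Import structures.
Require Import Defs.
From mathcomp Require Import all_boot all_order all_algebra.
From mathcomp Require Import all_classical all_reals all_analysis.
From mathcomp Require Import measurable_realfun lra finmap.

(** Replacing [X_t] by its right limit [X_{t+}] leaves every jump unchanged and
    yields a cadlag process [Y], which is adapted because the filtration is
    right-continuous ([regularization_adapted_cadlag],
    [jump_measure_regularization]).  For a fixed path, the jump measure is the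
    image of the counting measure of the jump times under
    [s |-> (s, Delta Y_s)] ([image_count]): it is therefore a measure, its
    values are integers or infinite, and it charges a vertical line by at most
    one.

    The substance is measurability in [(w, t)].  By compactness, for each
    [e > 0] and [T] a cadlag path has finitely many times such that an increment
    over a subinterval of [[0, T]] avoiding them is at most [e]
    ([cadlag_osc_partition]).  Hence the jumps larger than [e] are locally
    finite, and if [Phi] is continuous with [Phi (y, x) = 0] for [|x| <= e],
    then, along uniform grids of [[0, T]], the sums of
    [Phi (H_{t_{k+1}}, Y_{t_{k+1}} - Y_{t_k})] converge to the sum of
    [Phi (H_s, Delta Y_s)] over the jump times ([riemann_sum_jumps]).  These
    jump sums are thus F_T-measurable as soon as [H] and [Y] are adapted.  Now
    the sets [{H > 0} x {x > c}] with [H] cadlag adapted form a pi-system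
    generating O (x) B(R) ([half_generatorE]), and the indicators of their
    intersections with [{|x| > e}] are limits of such [Phi]; so by Dynkin's theorem the number of jumps larger than [e],
    up to time [t] and with mark in a given set of O (x) B(R), is adapted
    ([jump_kernel_adapted]).  As a function of [t] it is a locally constant
    cadlag path, hence an optional process ([jump_kernel_optional]).
    Decomposing the jumps by size removes the threshold [e]
    ([jump_kernel0_optional]), and the integral of [W] against this kernel is
    then optional for every nonnegative [W].

    For predictable sigma-finiteness, sort the jumps by size into countably many
    bands.  The number [N_{s-}] of jumps of band [n] strictly before [s] is
    finite, adapted and left-continuous in [s], so
    [{N_{s-} = k} x band n] is predictable; along each path it contains at most
    one jump, since [N] increases at each jump of the band
    ([layer_mass]). *)

Set Implicit Arguments.
Unset Strict Implicit.
Unset Printing Implicit Defensive.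

Import Order.TTheory GRing.Theory Num.Theory.
Import numFieldTopology.Exports numFieldNormedType.Exports.

Local Open Scope classical_set_scope.
Local Open Scope ring_scope.

(** * One-sided limits on the half-line *)

Section half_line.
Context {R : realType}.
Implicit Types (f h : Rplus R -> R) (s t a b : Rplus R).

(** A total inverse of [Rplus_val]; the absolute value makes [extend f] equal to
    [f \o to_Rplus] by definition. *)
Definition to_Rplus (r : R) : Rplus R := (`|r|%:nng : {nonneg R}).

Lemma Rplus_val_ge0 t : 0 <= Rplus_val t.
Proof. by rewrite /Rplus_val. Qed.

Lemma to_RplusK (r : R) : 0 <= r -> Rplus_val (to_Rplus r) = r.
Proof. by move=> r0; rewrite /Rplus_val/= ger0_norm. Qed.

Lemma Rplus_val_inj : injective (@Rplus_val R).
Proof. by move=> s t st; exact/val_inj. Qed.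

Lemma Rplus_valK : cancel (@Rplus_val R) to_Rplus.
Proof. by move=> t; apply: Rplus_val_inj; rewrite to_RplusK// Rplus_val_ge0. Qed.

Lemma le_Rplus s t : (s <= t)%O = (Rplus_val s <= Rplus_val t).
Proof. by []. Qed.

Lemma lt_Rplus s t : (s < t)%O = (Rplus_val s < Rplus_val t).
Proof. by []. Qed.

Lemma Rplus_val0 : Rplus_val (Rplus0 R) = 0.
Proof. by []. Qed.

Lemma gt0_Rplus t : t != Rplus0 R -> (Rplus0 R < t)%O.
Proof.
move=> t0; rewrite lt_Rplus lt_neqAle Rplus_val_ge0 andbT.
by apply: contra_neq t0 => /Rplus_val_inj.
Qed.

Lemma extendE f t : extend f (Rplus_val t) = f t.
Proof. by rewrite /extend -/(to_Rplus _) Rplus_valK. Qed.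

Lemma right_cvgP f t (l : R) :
  extend f r @[r --> (Rplus_val t)^'+] --> l <->
  forall e, 0 < e -> exists2 b, Rplus_val t < b &
    forall s, Rplus_val t < Rplus_val s < b -> `|l - f s| < e.
Proof.
split=> [/cvgrPdist_lt h e e0|h].
  have [d/= d0 hd] := h e e0.
  exists (Rplus_val t + d); first by rewrite ltrDl.
  move=> s /andP[ts sd]; rewrite -(extendE f); apply: hd => //=.
  by rewrite distrC ger0_norm ?subr_ge0 ?ltW// ltrBlDl.
apply/cvgrPdist_lt => e e0; have [b tb hb] := h e e0.
near=> r.
have tr : Rplus_val t < r by near: r; exact: nbhs_right_gt.
have r0 : 0 <= r by rewrite (le_trans (Rplus_val_ge0 t))// ltW.
rewrite -(to_RplusK r0) extendE; apply: hb; rewrite to_RplusK// tr/=.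
by near: r; exact: nbhs_right_lt.
Unshelve. all: by end_near. Qed.

Lemma left_cvgP f t (l : R) : (Rplus0 R < t)%O ->
  extend f r @[r --> (Rplus_val t)^'-] --> l <->
  forall e, 0 < e -> exists2 a, 0 <= a < Rplus_val t &
    forall s, a < Rplus_val s < Rplus_val t -> `|l - f s| < e.
Proof.
rewrite lt_Rplus => t0; split=> [/cvgrPdist_lt h e e0|h].
  have [d/= d0 hd] := h e e0.
  (* only the part of the neighbourhood inside the half-line carries values of [f] *)
  exists (Num.max 0 (Rplus_val t - d)).
    by rewrite le_max lexx/= gt_max t0/= ltrBlDr ltrDl.
  move=> s /andP[]; rewrite gt_max => /andP[s0 sd] st.
  rewrite -(extendE f); apply: hd => //=.
  by rewrite ger0_norm ?subr_ge0 ?ltW// ltrBlDr -ltrBlDl.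
apply/cvgrPdist_lt => e e0; have [b /andP[b0 tb] hb] := h e e0.
near=> r.
have br : b < r by near: r; exact: nbhs_left_gt.
have r0 : 0 <= r by rewrite (le_trans b0)// ltW.
rewrite -(to_RplusK r0) extendE; apply: hb; rewrite to_RplusK// br/=.
by near: r; exact: nbhs_left_lt.
Unshelve. all: by end_near. Qed.

Lemma cvg_right_seq f t (l : R) (u : nat -> Rplus R) :
  extend f r @[r --> (Rplus_val t)^'+] --> l ->
  Rplus_val (u n) @[n --> \oo] --> Rplus_val t ->
  (\forall n \near \oo, Rplus_val t < Rplus_val (u n)) ->
  f (u n) @[n --> \oo] --> l.
Proof.
move=> /right_cvgP h ut tu; apply/cvgrPdist_lt => e e0.
have [b tb hb] := h e e0.
near=> n; apply: hb; apply/andP; split; first by near: n.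
by near: n; exact: cvgr_lt ut _ _.
Unshelve. all: by end_near. Qed.

Lemma cvg_left_seq f t (l : R) (u : nat -> Rplus R) : (Rplus0 R < t)%O ->
  extend f r @[r --> (Rplus_val t)^'-] --> l ->
  Rplus_val (u n) @[n --> \oo] --> Rplus_val t ->
  (\forall n \near \oo, Rplus_val (u n) < Rplus_val t) ->
  f (u n) @[n --> \oo] --> l.
Proof.
move=> t0 /(left_cvgP _ _ t0) h ut tu; apply/cvgrPdist_lt => e e0.
have [b /andP[_ tb] hb] := h e e0.
near=> n; apply: hb; apply/andP; split; last by near: n.
by near: n; exact: cvgr_gt ut _ _.
Unshelve. all: by end_near. Qed.

(** Since a cadlag path takes the value of its right limit, the approximating
    sequence may touch the limit point. *)
Lemma cadlag_cvg_seq f t (u : nat -> Rplus R) : cadlag f ->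
  Rplus_val (u n) @[n --> \oo] --> Rplus_val t ->
  (\forall n \near \oo, Rplus_val t <= Rplus_val (u n)) ->
  f (u n) @[n --> \oo] --> f t.
Proof.
move=> [/(_ t)/right_cvgP h _] ut tu; apply/cvgrPdist_lt => e e0.
have [b tb hb] := h e e0.
near=> n.
have : Rplus_val t <= Rplus_val (u n) by near: n.
rewrite le_eqVlt => /predU1P[/Rplus_val_inj <-|tun].
  by rewrite subrr normr0.
apply: hb; rewrite tun/=.
by near: n; exact: cvgr_lt ut _ _.
Unshelve. all: by end_near. Qed.

Lemma left_limE f t : (Rplus0 R < t)%O ->
  left_lim f t = lim (extend f r @[r --> (Rplus_val t)^'-]).
Proof. by move=> t0; rewrite /left_lim gt_eqF. Qed.

Lemma cvg_left_lim f t : (Rplus0 R < t)%O -> cvg_left f t ->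
  extend f r @[r --> (Rplus_val t)^'-] --> left_lim f t.
Proof. by move=> t0; rewrite left_limE. Qed.

Lemma left_lim_unique f t (l : R) : (Rplus0 R < t)%O ->
  extend f r @[r --> (Rplus_val t)^'-] --> l -> left_lim f t = l.
Proof. by move=> t0 h; rewrite left_limE//; exact: cvg_lim h. Qed.

Lemma right_lim_unique f t (l : R) :
  extend f r @[r --> (Rplus_val t)^'+] --> l -> right_lim f t = l.
Proof. by move=> h; exact: cvg_lim h. Qed.

Lemma cadlag_right_lim f : cadlag f -> forall t, right_lim f t = f t.
Proof. by move=> [h _] t; apply: right_lim_unique. Qed.

Lemma jump0 f : jump f (Rplus0 R) = 0.
Proof. by rewrite /jump /left_lim eqxx subrr. Qed.

Section regularization.
Variable f : Rplus R -> R.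
Hypothesis fr : regulated f.

Lemma regulated_cvg_right t : extend f r @[r --> (Rplus_val t)^'+] --> right_lim f t.
Proof.
have [->|/gt0_Rplus t0] := eqVneq t (Rplus0 R); first exact: fr.2.
by have [] := fr.1 _ t0.
Qed.

Lemma regulated_cvg_left t : (Rplus0 R < t)%O ->
  extend f r @[r --> (Rplus_val t)^'-] --> left_lim f t.
Proof. by move=> t0; exact: (cvg_left_lim t0 (fr.1 _ t0).2). Qed.

(** A right limit is approximated by values of [f] at points that stay in any
    prescribed right neighbourhood; this transfers estimates on the values of
    [f] to estimates on its right limits. *)
Lemma right_lim_close s (e c : R) : 0 < e -> Rplus_val s < c ->
  exists s', Rplus_val s < Rplus_val s' < c /\ `|right_lim f s - f s'| < e.
Proof.
move=> e0 sc; have /right_cvgP/(_ e e0)[b sb hb] := @regulated_cvg_right s.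
pose r := (Rplus_val s + Num.min b c) / 2.
have sm : Rplus_val s < Num.min b c by rewrite lt_min sb.
have r0 : 0 <= r by have := Rplus_val_ge0 s; rewrite /r; lra.
have /andP[h1 h2] : Rplus_val s < r < Num.min b c by rewrite /r; lra.
move: h2; rewrite lt_min => /andP[rb rc].
by exists (to_Rplus r); rewrite to_RplusK// h1 rc; split=> //; apply: hb; rewrite to_RplusK// h1.
Qed.

Lemma right_lim_cvg_right t :
  extend (right_lim f) r @[r --> (Rplus_val t)^'+] --> right_lim f t.
Proof.
apply/right_cvgP => e e0.
have e20 : 0 < e / 2 by rewrite divr_gt0.
have /right_cvgP/(_ _ e20)[b tb hb] := @regulated_cvg_right t.
exists b => // s /andP[ts sb].
have [s' [/andP[ss' s'b] h]] := right_lim_close e20 sb.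
have h' := hb s'; rewrite (lt_trans ts)//= in h'; have {}h' := h' s'b.
rewrite [e]splitr (le_lt_trans (ler_distD (f s') _ _))// ltrD// distrC //.
Qed.

Lemma right_lim_cvg_left t : (Rplus0 R < t)%O ->
  extend (right_lim f) r @[r --> (Rplus_val t)^'-] --> left_lim f t.
Proof.
move=> t0; apply/left_cvgP => // e e0.
have e20 : 0 < e / 2 by rewrite divr_gt0.
have /(left_cvgP _ _ t0)/(_ _ e20)[b tb hb] := regulated_cvg_left t0.
exists b => // s /andP[bs st].
have [s' [/andP[ss' s't] h]] := right_lim_close e20 st.
have h' := hb s'; rewrite (lt_trans bs)//= in h'; have {}h' := h' s't.
rewrite [e]splitr (le_lt_trans (ler_distD (f s') _ _))// ltrD// distrC //.
Qed.

Lemma cadlag_regularization : cadlag (right_lim f).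
Proof.
split=> t; first exact: right_lim_cvg_right.
by move=> t0; apply/cvg_ex; exists (left_lim f t); exact: right_lim_cvg_left.
Qed.

(** The left limits of [right_lim f] are those of [f], while its right limits
    are its own values. *)
Lemma jump_regularization t : jump (right_lim f) t = jump f t.
Proof.
have [->|/gt0_Rplus t0] := eqVneq t (Rplus0 R); first by rewrite !jump0.
rewrite /jump cadlag_right_lim; last exact: cadlag_regularization.
by rewrite (left_lim_unique t0 (right_lim_cvg_left t0)).
Qed.

End regularization.

End half_line.

(** * Oscillation of cadlag paths *)

Section oscillation.
Context {R : realType}.
Implicit Types (f h : Rplus R -> R) (s t a b : Rplus R).

(** The times in [S] cut [[0, T]] into intervals, closed on the left and open on
    the right, on each of which [f] oscillates by at most [e]. *)
Definition osc_partition f (T : Rplus R) (e : R) (S : seq (Rplus R)) :=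
  (forall s, s \in S -> (Rplus0 R < s <= T)%O) /\
  forall a b, (a < b)%O -> (b <= T)%O ->
    (forall s, s \in S -> ~~ (a < s <= b)%O) -> `|f b - f a| <= e.

(** The endpoint [uw.1] is included in the left-hand estimate: it will become a
    point of the partition, and the half-open intervals there start at the
    partition points. *)
Lemma local_oscillation f e (r : R) : cadlag f -> 0 < e -> 0 <= r ->
  exists uw : R * R, [/\ uw.1 < r < uw.2,
    forall a b, uw.1 <= Rplus_val a < r -> uw.1 <= Rplus_val b < r -> `|f b - f a| <= e &
    forall a b, r <= Rplus_val a < uw.2 -> r <= Rplus_val b < uw.2 -> `|f b - f a| <= e].
Proof.
move=> fc e0 r0; have e20 : 0 < e / 2 by rewrite divr_gt0.
pose t := to_Rplus r; have tr : Rplus_val t = r by rewrite to_RplusK.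
have /right_cvgP/(_ _ e20)[w] := fc.1 t; rewrite tr => rw hw.
have {}hw a : r <= Rplus_val a < w -> `|f t - f a| <= e / 2.
  rewrite le_eqVlt => /andP[/predU1P[|ra aw]]; last by rewrite ltW// hw// ra.
  by rewrite -tr => /Rplus_val_inj ->; rewrite subrr normr0 ltW.
have [u [ur [l hu]]] : exists u, u < r /\ exists l,
    forall a, u <= Rplus_val a < r -> `|l - f a| <= e / 2.
  have [tE|/gt0_Rplus t0] := eqVneq t (Rplus0 R).
    have r00 : r = 0 by rewrite -tr tE.
    (* at the origin no time lies to the left, so the left-hand estimate is void *)
    exists (-1); rewrite r00 ltrN10; split=> //; exists 0 => a /andP[_].
    by rewrite ltNge Rplus_val_ge0.
  have /(left_cvgP _ _ t0)/(_ _ e20)[u] := cvg_left_lim t0 (fc.2 _ t0).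
  rewrite tr => /andP[u0 ur] hu; exists ((u + r) / 2); split; first lra.
  exists (left_lim f t) => a /andP[ua ar]; rewrite ltW// hu// ar andbT; lra.
exists (u, w); split=> /=; first by rewrite ur.
- move=> a b ha hb; rewrite [e]splitr (le_trans (ler_distD l _ _))// lerD ?hu//.
  by rewrite distrC hu.
- move=> a b ha hb; rewrite [e]splitr (le_trans (ler_distD (f t) _ _))// lerD ?hw//.
  by rewrite distrC hw.
Qed.

(** Finitely many of the intervals of [local_oscillation] cover [[0, T]]; their
    centres and left endpoints form the partition.  If [(a, b]] avoids them and
    [b] lies in the interval around [r], then [a] lies in the same interval and
    on the same side of [r] as [b]. *)
Lemma cadlag_osc_partition f T e : cadlag f -> 0 < e ->
  exists S, uniq S /\ osc_partition f T e S.
Proof.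
move=> fc e0.
have /choice[uw huw] : forall r : R, exists uw : R * R, 0 <= r -> [/\ uw.1 < r < uw.2,
    forall a b, uw.1 <= Rplus_val a < r -> uw.1 <= Rplus_val b < r -> `|f b - f a| <= e &
    forall a b, r <= Rplus_val a < uw.2 -> r <= Rplus_val b < uw.2 -> `|f b - f a| <= e].
  move=> r; have [r0|r0] := leP 0 r; last by exists (0, 0).
  by have [uw] := local_oscillation fc e0 r0; exists uw.
have := @segment_compact R 0 (Rplus_val T); rewrite compact_cover.
move=> /(_ R `[0, Rplus_val T]%classic (fun r => `](uw r).1, (uw r).2[%classic))[].
- by move=> r _; exact: interval_open.
- move=> r/= /[!in_itv]/= /[dup] rT /andP[r0 _]; exists r => /=; rewrite in_itv//=.
  by have [] := huw _ r0.
move=> D DT cov.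
(* some left endpoints, and a centre at [0], may lie outside [(0, T]] *)
pose S0 := [seq to_Rplus r | r <- [seq (uw r).1 | r <- enum_fset D] ++ enum_fset D].
pose S := undup [seq s <- S0 | (Rplus0 R < s <= T)%O].
exists S; split; first exact: undup_uniq.
split=> [s|a b ab bT hS]; first by rewrite mem_undup mem_filter => /andP[].
have [|r /= rD] := cov (Rplus_val b); first by rewrite /= in_itv/= Rplus_val_ge0.
rewrite in_itv/= => /andP[ub bw].
have /set_mem/= := DT _ rD; rewrite in_itv/= => /andP[r0 rT].
have [_ hu hw] := huw _ r0.
have inS x : x \in [seq (uw r).1 | r <- enum_fset D] ++ enum_fset D ->
    ~~ (Rplus_val a < x <= Rplus_val b).
  move=> xD; apply/negP => /andP[ax xb].
  have x0 : 0 < x by rewrite (le_lt_trans (Rplus_val_ge0 a)).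
  have := hS (to_Rplus x); rewrite /S mem_undup mem_filter map_f// andbT.
  rewrite !lt_Rplus !le_Rplus (to_RplusK (ltW x0)) Rplus_val0 x0 ax xb/=.
  by rewrite (le_trans xb)// => /(_ isT).
have := inS (uw r).1; rewrite mem_cat (map_f (fun r => (uw r).1) rD) => /(_ isT).
rewrite negb_and (ltW ub) orbF -leNgt => ua.
have := inS r; rewrite mem_cat [r \in enum_fset D]rD orbT => /(_ isT).
rewrite negb_and -leNgt -ltNge => rab.
have ab' : Rplus_val a < Rplus_val b by [].
have [br|rb] := ltP (Rplus_val b) r.
  by apply: hu; apply/andP; split => //; [exact: lt_trans br|exact: ltW].
move: rab; rewrite [_ < r]ltNge rb orbF => ra.
by apply: hw; apply/andP; split => //; exact: lt_trans bw.
Qed.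

Lemma near_all_seq (T : choiceType) {U} (F : set_system U) {FF : Filter F}
    (r : seq T) (P : T -> U -> Prop) :
  (forall i, i \in r -> \forall x \near F, P i x) ->
  \forall x \near F, forall i, i \in r -> P i x.
Proof.
elim: r => [|i r ih] h; first exact: nearW.
have hi : \forall x \near F, P i x by apply: h; rewrite mem_head.
have hr : \forall x \near F, forall j, j \in r -> P j x.
  by apply: ih => j jr; apply: h; rewrite in_cons jr orbT.
near=> x => j; rewrite in_cons => /predU1P[->|]; first by near: x.
by move: j; near: x.
Unshelve. all: by end_near. Qed.

Lemma gap_left (S : seq (Rplus R)) t : (Rplus0 R < t)%O ->
  exists2 a, (a < t)%O & forall s, s \in S -> ~~ (a < s < t)%O.
Proof.
move=> t0; elim: S => [|s S [a at_ ha]]; first by exists (Rplus0 R).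
have [st|ts] := ltP s t; last first.
  exists a => // u; rewrite in_cons => /predU1P[->|/ha//].
  by rewrite [(_ < t)%O]ltNge ts andbF.
have [sa|as_] := leP s a.
  exists a => // u; rewrite in_cons => /predU1P[->|/ha//].
  by rewrite ltNge sa.
exists s => // u; rewrite in_cons => /predU1P[->|/ha]; first by rewrite ltxx.
by apply: contra => /andP[su ->]; rewrite (lt_trans as_).
Qed.

Lemma gap_right (S : seq (Rplus R)) t (T : R) : Rplus_val t < T ->
  exists2 b, Rplus_val t < Rplus_val b < T & forall s, s \in S -> ~~ (t < s < b)%O.
Proof.
move=> tT; elim: S => [|s S [a /andP[ta aT] ha]].
  have t0 := Rplus_val_ge0 t.
  by exists (to_Rplus ((Rplus_val t + T) / 2)) => //; rewrite to_RplusK; lra.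
have [ts|st] := ltP t s; last first.
  exists a; [by rewrite ta|] => u; rewrite in_cons => /predU1P[->|/ha//].
  by rewrite ltNge st.
have [as_|sa] := leP a s.
  exists a; [by rewrite ta|] => u; rewrite in_cons => /predU1P[->|/ha//].
  by rewrite [(_ < a)%O]ltNge as_ andbF.
exists s.
  by rewrite -lt_Rplus ts/=; rewrite lt_Rplus in sa; exact: lt_trans aT.
move=> u; rewrite in_cons => /predU1P[->|/ha]; first by rewrite ltxx andbF.
by apply: contra => /andP[-> us]; rewrite (lt_trans us).
Qed.

Lemma seq_to_left t : (Rplus0 R < t)%O ->
  exists u : nat -> Rplus R,
    (forall n, (u n < t)%O) /\ Rplus_val (u n) @[n --> \oo] --> Rplus_val t.
Proof.
move=> t0; pose u n := to_Rplus (Rplus_val t * (1 - n.+1%:R^-1)).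
have uE n : Rplus_val (u n) = Rplus_val t * (1 - n.+1%:R^-1).
  rewrite to_RplusK// mulr_ge0 ?Rplus_val_ge0// subr_ge0 invf_le1//.
  by rewrite ler1n.
exists u; split => [n|].
  by rewrite lt_Rplus uE gtr_pMr ?ltrBlDr ?ltrDl ?invr_gt0.
have -> : (fun n => Rplus_val (u n)) = (fun n => Rplus_val t * (1 - harmonic n)).
  by apply/funext => n; rewrite uE.
have : Rplus_val t * (1 - harmonic n) @[n --> \oo] --> Rplus_val t * (1 - 0).
  by apply: cvgMl_tmp; apply: cvgB; [exact: cvg_cst|exact: cvg_harmonic].
by rewrite subr0 mulr1.
Qed.

Lemma seq_to_right t (T : R) : Rplus_val t < T ->
  exists u : nat -> Rplus R, (forall n, Rplus_val t < Rplus_val (u n) <= T) /\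
    Rplus_val (u n) @[n --> \oo] --> Rplus_val t.
Proof.
move=> tT; have d0 : 0 < T - Rplus_val t by rewrite subr_gt0.
pose u n := to_Rplus (Rplus_val t + (T - Rplus_val t) * n.+1%:R^-1).
have uE n : Rplus_val (u n) = Rplus_val t + (T - Rplus_val t) * n.+1%:R^-1.
  by rewrite to_RplusK// addr_ge0 ?Rplus_val_ge0// mulr_ge0// ltW.
exists u; split => [n|].
  rewrite uE ltrDl mulr_gt0//= -lerBrDl ler_piMr ?(ltW d0)// invf_le1//.
  by rewrite ler1n.
have -> : (fun n => Rplus_val (u n)) =
    (fun n => Rplus_val t + (T - Rplus_val t) * harmonic n).
  by apply/funext => n; rewrite uE.
have : Rplus_val t + (T - Rplus_val t) * harmonic n @[n --> \oo] -->
    Rplus_val t + (T - Rplus_val t) * 0.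
  by apply: cvgD; [exact: cvg_cst|apply: cvgMl_tmp; exact: cvg_harmonic].
by rewrite mulr0 addr0.
Qed.

(** Outside the partition, the increments over short intervals ending at [t]
    are at most [e], and they converge to the jump at [t]. *)
Lemma big_jump_in_partition f T e S t : cadlag f -> osc_partition f T e S ->
  (Rplus0 R < t <= T)%O -> e < `|jump f t| -> t \in S.
Proof.
move=> fc [_ oS] /andP[t0 tT]; apply: contraTT => tS; rewrite -leNgt.
have [a at_ ha] := gap_left S t0.
have [u [ut cu]] := seq_to_left t0.
have fu : f (u n) @[n --> \oo] --> left_lim f t.
  apply: (cvg_left_seq t0 (cvg_left_lim t0 (fc.2 _ t0))) => //.
  by apply: nearW => n; rewrite -lt_Rplus.
rewrite /jump cadlag_right_lim//.
have cn : `|f t - f (u n)| @[n --> \oo] --> `|f t - left_lim f t|.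
  by apply: cvg_norm; apply: cvgB; [exact: cvg_cst|exact: fu].
apply: (cvgr_to_le cn); near=> n.
apply: oS => // s sS; apply/negP => /andP[us st].
have /ha/negP := sS; apply.
apply/andP; split; last first.
  by rewrite lt_neqAle st andbT; apply: contraNneq tS => <-.
apply: lt_trans us; rewrite lt_Rplus; near: n.
by apply: cvgr_gt cu _ _.
Unshelve. all: by end_near. Qed.

End oscillation.

(** * Riemann sums of jumps *)

Section riemann_sums.
Context {R : realType}.
Implicit Types (f h : Rplus R -> R) (s t T a b : Rplus R).

Lemma cvg_sum_seq (I : choiceType) (r : seq I) (F : I -> nat -> R) (l : I -> R) :
  (forall i, i \in r -> F i n @[n --> \oo] --> l i) ->
  \sum_(i <- r) F i n @[n --> \oo] --> \sum_(i <- r) l i.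
Proof.
elim: r => [|i r ih] h.
  under eq_fun do rewrite big_nil.
  by rewrite big_nil; exact: cvg_cst.
under eq_fun do rewrite big_cons.
rewrite big_cons; apply: cvgD; first by apply: h; rewrite mem_head.
by apply: ih => j jr; apply: h; rewrite in_cons jr orbT.
Qed.

Definition grid T (n k : nat) : Rplus R := to_Rplus (Rplus_val T * k%:R / n.+1%:R).

Lemma gridE T n k : Rplus_val (grid T n k) = Rplus_val T * k%:R / n.+1%:R.
Proof. by rewrite to_RplusK// divr_ge0 ?mulr_ge0 ?Rplus_val_ge0. Qed.

Lemma le_grid T n k k' : (k <= k')%N -> (grid T n k <= grid T n k')%O.
Proof.
move=> kk; rewrite le_Rplus !gridE ler_wpM2r ?invr_ge0//.
by rewrite ler_wpM2l ?Rplus_val_ge0// ler_nat.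
Qed.

Lemma grid_last T n : grid T n n.+1 = T.
Proof. by apply: Rplus_val_inj; rewrite gridE mulfK. Qed.

Lemma grid_first T n : grid T n 0 = Rplus0 R.
Proof. by apply: Rplus_val_inj; rewrite gridE mulr0 mul0r Rplus_val0. Qed.

Lemma grid_step T n k :
  Rplus_val (grid T n k.+1) = Rplus_val (grid T n k) + Rplus_val T * harmonic n.
Proof. by rewrite !gridE -natr1 mulrDr mulr1 mulrDl. Qed.

Definition cell T (n k : nat) s := (grid T n k < s <= grid T n k.+1)%O.

Lemma cell_exists T n s : (Rplus0 R < s <= T)%O ->
  exists2 k, (k < n.+1)%N & cell T n k s.
Proof.
move=> /andP[s0 sT].
have exP : exists k, (s <= grid T n k.+1)%O by exists n; rewrite grid_last.
exists (ex_minn exP); case: ex_minnP => k sk kmin.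
  by rewrite ltnS kmin// grid_last.
rewrite /cell sk andbT; case: k sk kmin => [|k] sk kmin; first by rewrite grid_first.
by rewrite ltNge; apply/negP => /kmin; rewrite ltnn.
Qed.

Lemma cell_inj T n k k' s : cell T n k s -> cell T n k' s -> k = k'.
Proof.
move=> /andP[ks sk] /andP[ks' sk']; apply/eqP; rewrite eqn_leq.
apply/andP; split; rewrite leqNgt; apply/negP => kk.
  by have := lt_le_trans ks (le_trans sk' (le_grid T n kk)); rewrite ltxx.
by have := lt_le_trans ks' (le_trans sk (le_grid T n kk)); rewrite ltxx.
Qed.

Lemma cell_close T n k s s' : cell T n k s -> cell T n k s' ->
  `|Rplus_val s - Rplus_val s'| < Rplus_val T * harmonic n.
Proof.
rewrite /cell !lt_Rplus !le_Rplus grid_step => /andP[h1 h2] /andP[h3 h4].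
rewrite ltr_norml; lra.
Qed.

Lemma cvg_mesh T : Rplus_val T * harmonic n @[n --> \oo] --> (0 : R).
Proof.
rewrite -[X in _ --> X](mulr0 (Rplus_val T)); apply: cvgMl_tmp.
exact: cvg_harmonic.
Qed.


(** Only the cells that meet the partition [S] contribute, since over the other
    ones the increment is at most [e] and [Phi] vanishes.  For a fine grid a cell
    contains at most one point [s] of [S]; its right endpoint tends to [s] from
    the right, its left endpoint tends to [s] strictly from the left, so its
    contribution tends to [Phi (h s) (jump f s)]. *)
Lemma riemann_sum_jumps f h T (e : R) (S : seq (Rplus R)) (Phi : R -> R -> R) :
  cadlag f -> cadlag h -> 0 <= e -> uniq S -> osc_partition f T e S ->
  (forall y x, `|x| <= e -> Phi y x = 0) ->
  (forall (u w : nat -> R) y x, u n @[n --> \oo] --> y -> w n @[n --> \oo] --> x ->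
     Phi (u n) (w n) @[n --> \oo] --> Phi y x) ->
  \sum_(0 <= k < n.+1)
     Phi (h (grid T n k.+1)) (f (grid T n k.+1) - f (grid T n k)) @[n --> \oo]
    --> \sum_(s <- S) Phi (h s) (jump f s).
Proof.
move=> fc hc e0 uS [ST oS] Phi0 Phic.
pose F n k := Phi (h (grid T n k.+1)) (f (grid T n k.+1) - f (grid T n k)).
have /choice[kap hkap] : forall s, exists k : nat -> nat, s \in S ->
    forall n, (k n < n.+1)%N /\ cell T n (k n) s.
  move=> s; have [sS|_] := boolP (s \in S); last by exists (fun=> 0%N).
  have /choice[k hk] : forall n, exists k, (k < n.+1)%N /\ cell T n k s.
    by move=> n; have [k] := cell_exists n (ST _ sS); exists k.
  by exists k.
have Fcvg : \sum_(s <- S) F n (kap s n) @[n --> \oo] --> \sum_(s <- S) Phi (h s) (jump f s).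
  apply: (@cvg_sum_seq _ S (fun s n => F n (kap s n))) => s sS.
  have [s0 _] := andP (ST _ sS).
  have ks n : cell T n (kap s n) s by have [] := hkap _ sS n.
  have close n : `|Rplus_val s - Rplus_val (grid T n (kap s n).+1)| <= Rplus_val T * harmonic n /\
     `|Rplus_val s - Rplus_val (grid T n (kap s n))| <= Rplus_val T * harmonic n.
    have := ks n; rewrite /cell !lt_Rplus !le_Rplus grid_step => /andP[h1 h2].
    by rewrite !ler_norml; split; lra.
  have up : Rplus_val (grid T n (kap s n).+1) @[n --> \oo] --> Rplus_val s.
    apply/cvgrPdist_lt => d d0; near=> n; apply: (le_lt_trans (close n).1).
    by near: n; exact: cvgr_lt (cvg_mesh T) _ d0.
  have dn : Rplus_val (grid T n (kap s n)) @[n --> \oo] --> Rplus_val s.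
    apply/cvgrPdist_lt => d d0; near=> n; apply: (le_lt_trans (close n).2).
    by near: n; exact: cvgr_lt (cvg_mesh T) _ d0.
  have right_ : \forall n \near \oo, Rplus_val s <= Rplus_val (grid T n (kap s n).+1).
    by apply: nearW => n; have /andP[] := ks n.
  apply: Phic; first exact: cadlag_cvg_seq.
  rewrite /jump cadlag_right_lim//; apply: cvgB; first exact: cadlag_cvg_seq.
  apply: (cvg_left_seq s0 (cvg_left_lim s0 (fc.2 _ s0))) => //.
  by apply: nearW => n; have /andP[] := ks n.
apply: cvg_trans Fcvg; apply: near_eq_cvg.
(* once the mesh is below the least distance between points of [S], distinct
   points lie in distinct cells *)
have sep : \forall n \near \oo, forall s, s \in S -> forall s', s' \in S ->
    s != s' -> kap s n != kap s' n.
  apply: near_all_seq => s sS; apply: near_all_seq => s' s'S.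
  have [->|ss'] := eqVneq s s'; first by apply: nearW => n; rewrite eqxx.
  have d0 : 0 < `|Rplus_val s - Rplus_val s'|.
    by rewrite normr_gt0 subr_eq0; apply: contra_neq ss' => /Rplus_val_inj.
  near=> n => _; apply/eqP => kk.
  have c1 := (hkap _ sS n).2; have c2 := (hkap _ s'S n).2.
  rewrite -kk in c2; have := cell_close c1 c2; apply/negP; rewrite -leNgt ltW//.
  by near: n; exact: cvgr_lt (cvg_mesh T) _ d0.
near=> n.
have sepn : forall s, s \in S -> forall s', s' \in S -> s != s' -> kap s n != kap s' n.
  by near: n.
have kap_inj : {in S &, injective (kap^~ n)}.
  move=> s s' sS s'S /= kk; apply/eqP/negPn/negP => /(sepn _ sS _ s'S).
  by rewrite kk eqxx.
(* [M] lists the cells that meet [S]; the sum over all cells reduces to it *)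
pose M := [seq kap s n | s <- S].
rewrite -/(F n _) -(big_map (kap^~ n) xpredT (F n)) -/M.
rewrite [RHS](bigID (mem M))/= [X in _ + X]big1_seq ?addr0; last first.
  move=> k /andP[kM]; rewrite mem_index_iota => /andP[_ kn].
  apply: Phi0.
  have [ab|ba] := ltP (grid T n k) (grid T n k.+1); last first.
    have -> : grid T n k.+1 = grid T n k.
      by apply/le_anti; rewrite ba le_grid.
    by rewrite subrr normr0.
  apply: oS => //; first by rewrite -[X in (_ <= X)%O](grid_last T n) le_grid.
  move=> s sS; apply: contra kM => sk.
  by rewrite (cell_inj sk (hkap _ sS n).2) map_f.
rewrite -[RHS]big_filter; apply: perm_big; apply: uniq_perm.
- by rewrite map_inj_in_uniq.
- by rewrite filter_uniq// iota_uniq.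
move=> k; rewrite mem_filter mem_index_iota /= andb_idr//.
by move=> /mapP[s sS ->]; have [] := hkap _ sS n.
Unshelve. all: by end_near. Qed.

End riemann_sums.

(** * Counting measures *)

Section ecard.
Context {R : realType} {I : choiceType}.
Implicit Types A B : set I.
Local Open Scope ereal_scope.

(** The cardinality of [A] as an extended real; the form of a sum over [A] gives
    sigma-additivity for free. *)
Definition ecard A : \bar R := \esum_(s in A) 1.

Lemma ecard0 : ecard set0 = 0.
Proof. exact: esum_set0. Qed.

Lemma ecard_ge0 A : 0 <= ecard A.
Proof. exact: esum_ge0. Qed.

Lemma le_ecard A B : A `<=` B -> ecard A <= ecard B.
Proof.
move=> AB; rewrite /ecard esum_mkcond [leRHS]esum_mkcond; apply: le_esum => i _.
case: ifPn => [/set_mem/AB/mem_set ->//|_]; by case: ifPn.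
Qed.

Lemma ecard_subset1 A : is_subset1 A -> ecard A <= 1.
Proof.
move=> A1; have [->|/set0P[x Ax]] := eqVneq A set0; first by rewrite ecard0.
suff -> : A = [set x] by rewrite /ecard esum_set1.
by apply/seteqP; split => [y Ay|y ->//]; exact: A1.
Qed.

Lemma ecard_finite A : finite_set A -> ecard A = (#|` fset_set A|%fset)%:R%:E.
Proof.
move=> fA; rewrite /ecard esum_fset// fsbig_finite//=.
by rewrite sumEFin big_const_seq count_predT iter_addr_0.
Qed.

Lemma ecard_fin_num A : finite_set A -> ecard A \is a fin_num.
Proof. by move=> /ecard_finite ->. Qed.

Lemma ecard_infinite A : infinite_set A -> ecard A = +oo.
Proof.
move=> iA; apply/eq_infty => y.
have [n yn] : exists n : nat, (y <= n%:R)%R.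
  by exists (Num.truncn y).+1; rewrite ltW// truncnS_gt.
have [B BA nB] := infinite_set_fset n iA.
apply: (@le_trans _ _ (ecard [set` B])); last exact: le_ecard.
by rewrite ecard_finite// set_fsetK lee_fin (le_trans yn)// ler_nat.
Qed.

Lemma ecard_integer A : (exists n : nat, ecard A = n%:R%:E) \/ ecard A = +oo.
Proof.
have [fA|iA] := pselect (finite_set A); last by right; exact: ecard_infinite.
by left; eexists; exact: ecard_finite.
Qed.

Lemma ecard_bigcup (F : nat -> set I) : trivIset setT F ->
  ecard (\bigcup_n F n) = \sum_(0 <= n <oo) ecard (F n).
Proof. by move=> tF; rewrite /ecard nneseries_sum_bigcup. Qed.

End ecard.

Section image_count.
Context {R : realType} {I : choiceType} {d : measure_display} {T : measurableType d}.
Variables (J : set I) (e : I -> T).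
Local Open Scope ereal_scope.

(** The image under [e] of the counting measure on [J]. *)
Definition image_count (G : set T) : \bar R := ecard (J `&` e @^-1` G).

Let image_count0 : image_count set0 = 0.
Proof. by rewrite /image_count preimage_set0 setI0 ecard0. Qed.

Let image_count_ge0 G : 0 <= image_count G.
Proof. exact: ecard_ge0. Qed.

Let image_count_sigma_additive : semi_sigma_additive image_count.
Proof.
move=> F mF tF mUF; rewrite /image_count preimage_bigcup setI_bigcupr ecard_bigcup.
  by apply: is_cvg_nneseries => n _ _; exact: ecard_ge0.
move=> i j _ _ [x [[_ xi] [_ xj]]]; apply: (tF i j) => //.
by exists (e x).
Qed.

HB.instance Definition _ := isMeasure.Build d T R image_count
  image_count0 image_count_ge0 image_count_sigma_additive.

End image_count.

Section jump_measure_as_image.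
Context {d : measure_display} {Omega : measurableType d} {R : realType}.
Implicit Types (X : Omega * Rplus R -> R) (w : Omega).
Local Open Scope ereal_scope.

Definition mark (f : Rplus R -> R) (s : Rplus R) : (Rplus R * R)%type := (s, jump f s).

Lemma jump_measureE X w : jump_measure X w =
  image_count (jump_times (trajectory X w)) (mark (trajectory X w)).
Proof.
apply/funext => G; rewrite /jump_measure /image_count /ecard.
pose B := [set s | jump (trajectory X w) s != 0%R] `&` mark (trajectory X w) @^-1` G.
have -> : jump_times (trajectory X w) `&` mark (trajectory X w) @^-1` G =
    [set s | (Rplus0 R < s)%O] `&` B by rewrite setIA.
rewrite esum_mkcondr; apply: eq_esum => s _.
rewrite !indicE.
have -> : (s \in B) = ((w, s) \in jump_set X) && ((s, jump (trajectory X w) s) \in G).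
  by rewrite in_setI.
by case: (_ \in jump_set _); case: (_ \in G) => /=; rewrite ?mulr1 ?mulr0 ?mul0r.
Qed.

End jump_measure_as_image.

(** * Measurability of paths and of adapted processes *)

Section borel_paths.
Context {R : realType}.
Implicit Types (f : Rplus R -> R).

Lemma measurable_Rplus_val : measurable_fun setT (@Rplus_val R).
Proof. by move=> _ B mB; exists B. Qed.

Lemma measurable_fun_natfactor {d d'} {T : measurableType d} {T' : measurableType d'}
    (phi : T -> nat) (g : nat -> T') :
  (forall k, measurable (phi @^-1` [set k])) -> measurable_fun setT (g \o phi).
Proof.
move=> mphi _ B mB; rewrite setTI.
rewrite [X in measurable X](_ : _ = \bigcup_(k in g @^-1` B) phi @^-1` [set k]).
  by apply: bigcup_measurable => k _.
by apply/seteqP; split => [t Bt|t [k Bk /= tk]]; [exists (phi t)|rewrite /= tk].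
Qed.

(** A right-continuous path is the pointwise limit of its values at the grid
    points of mesh [1 / n] that lie next to the right of [t]. *)
Lemma cadlag_measurable f : cadlag f -> measurable_fun setT f.
Proof.
move=> fc.
pose phi n (t : Rplus R) := Num.truncn (n.+1%:R * Rplus_val t).
pose g n k := f (to_Rplus (k.+1%:R / n.+1%:R)).
have mphi n k : measurable (phi n @^-1` [set k]).
  have mt : measurable_fun setT (fun t : Rplus R => n.+1%:R * Rplus_val t).
    by apply: measurable_funM => //; exact: measurable_Rplus_val.
  rewrite [X in measurable X](_ : _ =
      (fun t => n.+1%:R * Rplus_val t) @^-1` `[k%:R, k.+1%:R[%classic).
    by rewrite -[X in measurable X]setTI; apply: mt.
  apply/seteqP; split => t; rewrite /= in_itv/=.
    by move=> <-; rewrite truncn_itv// mulr_ge0// Rplus_val_ge0.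
  by move=> h; apply/eqP; rewrite truncn_eq// mulr_ge0// Rplus_val_ge0.
apply: (@measurable_fun_cvg _ _ _ _ (fun n => g n \o phi n)).
  by move=> n; exact: measurable_fun_natfactor.
move=> t _; apply: cadlag_cvg_seq => //.
  apply/cvgrPdist_lt => e e0; near=> n.
  have := @truncn_itv R (n.+1%:R * Rplus_val t); rewrite mulr_ge0 ?Rplus_val_ge0// => /(_ isT).
  rewrite -/(phi n t) to_RplusK// => /andP[h1 h2].
  have n0 : 0 < n.+1%:R^-1 :> R by rewrite invr_gt0.
  have e1 : n.+1%:R^-1 < e by near: n; exact: (near_infty_natSinv_lt (PosNum e0)).
  apply: le_lt_trans e1; rewrite ler_norml; apply/andP; split.
    rewrite lerBrDl -{2}[n.+1%:R^-1]mul1r -mulNr -mulrDl.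
    rewrite -[X in _ <= X](mulfK (_ : n.+1%:R != 0)) //.
    by rewrite ler_wpM2r ?(ltW n0)// [leRHS]mulrC -natr1; lra.
  have : Rplus_val t <= (phi n t).+1%:R / n.+1%:R by rewrite ler_pdivlMr// mulrC ltW.
  by rewrite -subr_le0 => /le_trans; apply; exact: ltW.
apply: nearW => n; rewrite to_RplusK// ler_pdivlMr// mulrC ltW//.
have := @truncn_itv R (n.+1%:R * Rplus_val t).
by rewrite mulr_ge0 ?Rplus_val_ge0// => /(_ isT)/andP[].
Unshelve. all: by end_near. Qed.

End borel_paths.

Section filtered.
Context {d : measure_display} {Omega : measurableType d} {R : realType}.
Variable F : Rplus R -> set_system Omega.
Hypothesis hF : filtration F.
Implicit Types (X Y H : Omega * Rplus R -> R) (w : Omega) (t : Rplus R).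

(** Random variables on [filtType F t] are the F_t-measurable ones, which makes
    the closure properties of measurable functions available for adapted
    processes. *)
Definition filtType t := g_sigma_algebraType (F t).

Lemma measurable_filtType t (A : set Omega) :
  measurable (A : set (filtType t)) <-> F t A.
Proof.
have [h _ _] := hF.
have E : <<s F t >> = F t by exact: sigma_algebra_id.
by rewrite -[X in _ <-> X A]E.
Qed.

Lemma adaptedP Y : adapted F Y <->
  forall t, measurable_fun setT ((fun w => Y (w, t)) : filtType t -> R).
Proof.
split=> h t.
  by move=> _ B mB; rewrite setTI; apply/measurable_filtType; exact: h.
by move=> B mB; apply/measurable_filtType; rewrite -[X in measurable X]setTI; apply: h.
Qed.

Lemma filt_measurable s t (Z : Omega -> R) : (s <= t)%O ->
  measurable_fun setT (Z : filtType s -> R) -> measurable_fun setT (Z : filtType t -> R).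
Proof.
move=> st mZ _ B mB; apply/measurable_filtType.
have [_ _ h] := hF; apply: (h _ _ st); apply/measurable_filtType.
exact: mZ.
Qed.

Lemma measurable_optional_section t :
  measurable_fun setT ((fun w => (w, t)) : filtType t -> optionalType F).
Proof.
apply: (@measurability _ _ (filtType t) (optionalType F) setT _
  (optional_generator F) erefl) => _ [A [Y [aY _ [B mB ->]]] <-].
by rewrite setTI; apply/measurable_filtType; exact: aY.
Qed.

Lemma measurable_optional_path w :
  measurable_fun setT ((fun t => (w, t)) : Rplus R -> optionalType F).
Proof.
apply: (@measurability _ _ (Rplus R) (optionalType F) setT _
  (optional_generator F) erefl) => _ [A [Y [_ cY [B mB ->]]] <-].
by apply: (cadlag_measurable (cY w)).
Qed.

Lemma optional_adapted X : optional_process F X -> adapted F X.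
Proof.
move=> oX; apply/adaptedP => t.
exact: (measurableT_comp (T1 := filtType t) (T2 := optionalType F) oX
  (@measurable_optional_section t)).
Qed.

Definition adapted_cadlag Y := adapted F Y /\ forall w, cadlag (trajectory Y w).

Lemma adapted_cadlag_optional Y : adapted_cadlag Y -> optional_process F Y.
Proof.
move=> [aY cY] _ B mB; rewrite setTI; apply: sub_sigma_algebra.
by exists Y; split => //; exists B.
Qed.

Definition regularization X : Omega * Rplus R -> R :=
  fun p => right_lim (trajectory X p.1) p.2.

(** For every [s > t] the right limit at [t] is a limit of values taken at times
    of [(t, s]], hence F_s-measurable; right-continuity of the filtration
    concludes. *)
Lemma regularization_adapted_cadlag X : optional_process F X ->
  (forall t, F t = \bigcap_(s in [set s | (t < s)%O]) F s) ->
  (forall w, regulated (trajectory X w)) -> adapted_cadlag (regularization X).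
Proof.
move=> oX rF rX; split; last by move=> w; exact: (cadlag_regularization (rX w)).
move=> t B mB; rewrite rF => s /= ts; apply/(@measurable_filtType s).
have [u [ut cu]] := seq_to_right ts.
have mu_ n : measurable_fun setT ((fun w => X (w, u n)) : filtType s -> R).
  apply: (@filt_measurable (u n)).
    by rewrite le_Rplus; have /andP[] := ut n.
  by have /adaptedP := optional_adapted oX; apply.
rewrite -[X in measurable X]setTI.
apply: (@measurable_fun_cvg _ (filtType s) _ setT (fun n w => X (w, u n))) => // w _.
apply: (@cvg_right_seq _ (trajectory X w) t _ u) => //.
  exact: regulated_cvg_right.
by apply: nearW => n; have /andP[] := ut n.
Qed.

End filtered.

(** * A pi-system generating the optional product sigma-field *)

Section ramps.
Context {R : realType}.

(** A continuous approximation, increasing in [m], of the indicator function of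
    the positive half-line. *)
Definition ramp (m : nat) (z : R) : R := Num.min 1 (m%:R * Num.max 0 z).

Lemma continuous_ramp m : continuous (ramp m).
Proof.
move=> z; apply: (@continuous_min R R (cst 1) (fun z => m%:R * Num.max 0 z)).
  exact: cvg_cst.
apply: cvgMl_tmp.
exact: (@continuous_max R R (cst 0) id z (@cvg_cst _ _ _ _ _) (@cvg_id _ _)).
Qed.

Lemma ramp_le0 m z : z <= 0 -> ramp m z = 0.
Proof. by move=> z0; rewrite /ramp (max_idPl z0) mulr0 (min_idPr ler01). Qed.

Lemma cvg_ramp (z : R) : ramp m z @[m --> \oo] --> ((0 < z)%R%:R : R).
Proof.
have [z0|z0] := ltP 0 z; last first.
  by under eq_fun do rewrite ramp_le0//; exact: cvg_cst.
apply: (@cvg_trans _ (cst (1:R) @ \oo)); last exact: cvg_cst.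
apply: near_eq_cvg; near=> m; rewrite /ramp (max_idPr (ltW z0)); apply/esym/min_idPl.
rewrite -ler_pdivrMr// mul1r; near: m; exact: nbhs_infty_ger.
Unshelve. all: by end_near. Qed.

(** A continuous approximation of the indicator function of
    [0 < y /\ c < x /\ e < |x|], to which [riemann_sum_jumps] applies because it
    vanishes for [|x| <= e]. *)
Definition cutoff (m : nat) (c e y x : R) : R :=
  ramp m y * ramp m (x - c) * ramp m (`|x| - e).

Lemma cutoff0 m c e y x : `|x| <= e -> cutoff m c e y x = 0.
Proof. by move=> xe; rewrite /cutoff [ramp _ (_ - e)]ramp_le0 ?mulr0// subr_le0. Qed.

Lemma cutoff_cvg m c e {T} (F : set_system T) {FF : Filter F} (u w : T -> R) y x :
  u n @[n --> F] --> y -> w n @[n --> F] --> x ->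
  cutoff m c e (u n) (w n) @[n --> F] --> cutoff m c e y x.
Proof.
move=> uy wx; apply: cvgM; first apply: cvgM.
- by apply: continuous_cvg => //; exact: continuous_ramp.
- apply: continuous_cvg; first exact: continuous_ramp.
  by apply: cvgB => //; exact: cvg_cst.
- apply: continuous_cvg; first exact: continuous_ramp.
  by apply: cvgB; [exact: cvg_norm|exact: cvg_cst].
Qed.

Lemma cvg_cutoff c e y x :
  cutoff m c e y x @[m --> \oo] --> ([&& 0 < y, c < x & e < `|x|]%:R : R).
Proof.
have -> : ([&& 0 < y, c < x & e < `|x|]%:R : R) =
    (0 < y)%R%:R * (0 < x - c)%R%:R * (0 < `|x| - e)%R%:R.
  by rewrite !subr_gt0 andbA -!mulnb !natrM.
by apply: cvgM; [apply: cvgM|]; exact: cvg_ramp.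
Qed.

Lemma measurable_cutoff m c e d (T : measurableType d) (u w : T -> R) :
  measurable_fun setT u -> measurable_fun setT w ->
  measurable_fun setT (fun z => cutoff m c e (u z) (w z)).
Proof.
move=> mu_ mw.
have mr : measurable_fun setT (ramp m).
  by apply: continuous_measurable_fun; exact: continuous_ramp.
apply: measurable_funM; first apply: measurable_funM.
- exact: measurableT_comp mr mu_.
- apply: (measurableT_comp mr); apply: measurable_funB => //.
- apply: (measurableT_comp mr); apply: measurable_funB => //.
  exact: measurableT_comp.
Qed.

End ramps.

Section cadlag_closure.
Context {R : realType}.

Lemma cadlag_map2 (phi : R -> R -> R) (f h : Rplus R -> R) :
  (forall T (F : set_system T) (FF : Filter F) (u w : T -> R) (y x : R),
    u z @[z --> F] --> y -> w z @[z --> F] --> x ->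
    phi (u z) (w z) @[z --> F] --> phi y x) ->
  cadlag f -> cadlag h -> cadlag (fun t => phi (f t) (h t)).
Proof.
move=> phic fc hc; split=> t.
  by apply: phic; [exact: fc.1|exact: hc.1].
move=> t0; apply/cvg_ex; exists (phi (left_lim f t) (left_lim h t)).
by apply: phic; apply: cvg_left_lim => //; [exact: fc.2|exact: hc.2].
Qed.

Lemma cadlag_cst (c : R) : cadlag (fun=> c : R).
Proof.
split=> t; first exact: cvg_cst.
by move=> _; exact: is_cvg_cst.
Qed.

End cadlag_closure.

Section optional_generators.
Context {d : measure_display} {Omega : measurableType d} {R : realType}.
Variable F : Rplus R -> set_system Omega.
Hypothesis hF : filtration F.
Implicit Types (X Y H : Omega * Rplus R -> R) (w : Omega) (t : Rplus R).

Definition half_set H c : set (optionalType F * R) :=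
  [set y | 0 < H y.1 /\ c < y.2].

(** These sets are stable under intersection because the minimum of two cadlag
    adapted processes is again one, and they generate because the sets
    [{Y > c}] are of the form [{H > 0}]. *)
Definition half_generator : set_system (optionalType F * R) :=
  [set U | exists H c, adapted_cadlag F H /\ U = half_set H c].

Lemma adapted_cadlag_cst c : adapted_cadlag F (fun=> c).
Proof.
split; last by move=> w; exact: cadlag_cst.
by apply/(adaptedP hF) => t; exact: measurable_cst.
Qed.

Lemma adapted_cadlagB H c : adapted_cadlag F H -> adapted_cadlag F (fun p => H p - c).
Proof.
move=> [aH cH]; split.
  apply/(adaptedP hF) => t; apply: measurable_funB => //.
  by move/(adaptedP hF) : aH; apply.
move=> w; apply: (@cadlag_map2 _ (fun y _ => y - c) _ _ _ (cH w) (cH w)).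
by move=> T G FG u v y x uy _; apply: cvgB => //; exact: cvg_cst.
Qed.

Lemma adapted_cadlag_min H H' : adapted_cadlag F H -> adapted_cadlag F H' ->
  adapted_cadlag F (fun p => Num.min (H p) (H' p)).
Proof.
move=> [aH cH] [aH' cH']; split.
  apply/(adaptedP hF) => t; apply: measurable_minr.
    by move/(adaptedP hF) : aH; apply.
  by move/(adaptedP hF) : aH'; apply.
move=> w; apply: (@cadlag_map2 _ Num.min _ _ _ (cH w) (cH' w)).
move=> T G FG u v y x uy vx.
have E (a b : R) : Num.min a b = (a + b - `|a - b|) / 2 by rewrite minr_absE.
rewrite E (_ : (fun z => Num.min (u z) (v z)) = fun z => (u z + v z - `|u z - v z|) / 2).
  apply: cvgMr_tmp; apply: cvgB; first exact: cvgD.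
  by apply: cvg_norm; exact: cvgB.
by apply/funext => z; rewrite E.
Qed.

Lemma half_generator_setI : setI_closed half_generator.
Proof.
move=> _ _ [H [c [aH ->]]] [H' [c' [aH' ->]]].
exists (fun p => Num.min (H p) (H' p)), (Num.max c c'); split.
  exact: adapted_cadlag_min.
apply/seteqP; split => y; rewrite /half_set/= lt_min gt_max.
  by move=> [[-> ->] [-> ->]].
by move=> [/andP[-> ->] /andP[-> ->]].
Qed.

Lemma measurable_half_set H c : adapted_cadlag F H ->
  measurable (half_set H c).
Proof.
move=> /(adapted_cadlag_optional)/(_ measurableT `]0, +oo[%classic) oH.
rewrite (_ : half_set H c = [set p | 0 < H p] `*` `]c, +oo[%classic).
  apply: measurableX => //; rewrite [X in measurable X](_ : _ =
      [set: optionalType F] `&` (H : optionalType F -> R) @^-1` `]0, +oo[%classic).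
    exact: oH.
  by rewrite setTI; apply/seteqP; split => p /=; rewrite in_itv/= andbT.
by apply/seteqP; split => y /=; rewrite in_itv/= andbT.
Qed.

Lemma half_generatorE : @measurable _ (optionalType F * R)%type = <<s half_generator >>.
Proof.
apply/seteqP; split => U.
  have mfst : measurable_fun setT (fst : g_sigma_algebraType half_generator -> optionalType F).
    apply: (@measurability _ _ (g_sigma_algebraType half_generator) (optionalType F)
      setT _ (optional_generator F) erefl) => _ [_ [Y [aY cY [B mB ->]]] <-].
    suff mY : measurable_fun setT ((fun y => Y y.1) : g_sigma_algebraType half_generator -> R).
      exact: mY.
    apply: (measurability _ (RGenOInfty.measurableE R)) => _ [_ [c ->] <-].
    rewrite setTI [X in measurable X](_ : _ =
        \bigcup_n half_set (fun p => Y p - c) (- n%:R)).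
      apply: bigcup_measurable => n _; apply: sub_sigma_algebra.
      exists (fun p => Y p - c), (- n%:R); split => //.
      exact: adapted_cadlagB.
    apply/seteqP; split => y /=; rewrite in_itv/= andbT.
      move=> cy; exists (Num.truncn `|y.2|).+1 => //; split => /=.
        by rewrite subr_gt0.
      by rewrite ltrNl (le_lt_trans _ (truncnS_gt _))// -normrN ler_norm.
    by move=> [n _ [/=]]; rewrite subr_gt0.
  have msnd : measurable_fun setT (snd : g_sigma_algebraType half_generator -> R).
    apply: (measurability _ (RGenOInfty.measurableE R)) => _ [_ [c ->] <-].
    rewrite setTI [X in measurable X](_ : _ = half_set (fun=> 1) c).
      by apply: sub_sigma_algebra; exists (fun=> 1), c; split => //; exact: adapted_cadlag_cst.
    apply/seteqP; split => y /=; rewrite in_itv/= andbT; last by case.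
    by move=> ?; split.
  move=> mU.
  have := measurable_fun_pair mfst msnd measurableT mU.
  rewrite setTI; congr (_ _); apply/seteqP.
  by split=> -[].
apply: smallest_sub; first exact: sigma_algebra_measurable.
by move=> _ [H [c [aH ->]]]; exact: measurable_half_set.
Qed.

End optional_generators.

(** * The kernel counting large jumps *)

Section big_jumps.
Context {R : realType}.
Implicit Types (f : Rplus R -> R) (t : Rplus R) (e : R).

Definition big_jumps f t e : set (Rplus R) :=
  [set s | jump_times f s /\ (s <= t)%O /\ e < `|jump f s|].

Lemma finite_big_jumps f t e : cadlag f -> 0 < e -> finite_set (big_jumps f t e).
Proof.
move=> fc e0; have [S [_ oS]] := cadlag_osc_partition t fc e0.
apply: (@sub_finite_set _ _ [set` S]); last exact: finite_seq.
move=> s [[s0 _] [st es]] /=; apply: (big_jump_in_partition fc oS) => //.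
by rewrite s0.
Qed.

(** Turns the cardinality of a finite set of jump times into a real sum over a
    partition, to be compared with [riemann_sum_jumps]. *)
Lemma ecard_in_seq (I : choiceType) (S : seq I) (p : pred I) (A : set I) :
  uniq S -> A = [set s | s \in S /\ p s] ->
  ecard A = (\sum_(s <- S) (p s)%:R : R)%:E.
Proof.
move=> uS ->; rewrite /ecard.
rewrite (_ : [set s | _] = [set` S] `&` [set s | p s]); last by [].
rewrite esum_mkcondr esum_fset//; last by move=> i _; case: ifP.
rewrite -fsbig_seq// -sumEFin; apply: eq_bigr => s _.
by case: ifPn => [/set_mem/= ->//|/negP ps]; case: (boolP (p s)) => // /mem_set.
Qed.

End big_jumps.

Section bands.
Context {R : realType}.

(** For [x != 0], the integer part of [1 / |x|] sorts the jumps by size; a jump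
    in [band n] is larger than [1 / (n + 1)].  The value at [x = 0], where the
    inverse is [0], puts [0] in [band 0], so that the bands cover the line. *)
Definition band (n : nat) : set R := [set x | Num.truncn `|x|^-1 = n].

Lemma band_gt n (x : R) : band n x -> x != 0 -> n.+1%:R^-1 < `|x|.
Proof.
rewrite /band/= => nx x0; have x_gt0 : 0 < `|x| by rewrite normr_gt0.
by rewrite -[ltRHS]invrK ltf_pV2 ?posrE ?invr_gt0// -nx truncnS_gt.
Qed.

Lemma measurable_band n : measurable (band n).
Proof.
pose L (m : nat) : set R := [set x | `|x|^-1 < m%:R].
have mL m : measurable (L m).
  case: m => [|m].
    rewrite (_ : L _ = set0)//; apply/seteqP; split => x //=.
    by rewrite /L/= ltNge invr_ge0 normr_ge0.
  rewrite (_ : L _ = [set 0] `|` (fun x : R => `|x|) @^-1` `]m.+1%:R^-1, +oo[%classic).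
    apply: measurableU => //; rewrite -[X in measurable X]setTI.
    exact: normr_measurable.
  apply/seteqP; split => x; rewrite /L/= in_itv/= andbT.
    have [->|x0] := eqVneq x 0; first by left.
    by rewrite -[ltLHS]invrK => h; right;
      rewrite -ltf_pV2 ?posrE ?invr_gt0 ?normr_gt0// invrK -[ltLHS]invrK.
  move=> [->|h]; first by rewrite normr0 invr0.
  by rewrite -[ltRHS]invrK ltf_pV2 ?posrE ?invr_gt0// (lt_trans _ h)// invr_gt0.
rewrite (_ : band n = L n.+1 `\` L n); first exact: measurableD.
apply/seteqP; split => x; rewrite /band /L /=.
  by move=> <-; rewrite truncnS_gt; split=> //; apply/negP; rewrite -leNgt truncn_le.
move=> [h1 /negP]; rewrite -leNgt => h2; apply/eqP.
by rewrite truncn_eq ?invr_ge0// h2.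
Qed.

Lemma trivIset_band : trivIset setT band.
Proof. by move=> m n _ _ [x [/= <- <-]]. Qed.

End bands.

Section locally_constant.
Context {R : realType}.
Implicit Types (f : Rplus R -> R) (t : Rplus R) (e : R).

(** The jumps larger than [e] being locally finite, none occurs immediately
    after [t]. *)
Lemma big_jumps_right f t e : cadlag f -> 0 < e -> exists2 b, Rplus_val t < b &
  forall s, Rplus_val t <= Rplus_val s < b -> big_jumps f s e = big_jumps f t e.
Proof.
move=> fc e0; pose T := to_Rplus (Rplus_val t + 1).
have TE : Rplus_val T = Rplus_val t + 1 by rewrite to_RplusK// addr_ge0// Rplus_val_ge0.
have [S [_ oS]] := cadlag_osc_partition T fc e0.
have tT : Rplus_val t < Rplus_val T by rewrite TE ltrDl.
have [b /andP[tb bT] hb] := gap_right S tT.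
exists (Rplus_val b) => // s /andP[ts sb].
apply/seteqP; split => u [ju [us eu]]; split => //; split => //; last first.
  by rewrite le_Rplus (le_trans _ ts).
rewrite leNgt; apply/negP => tu.
have uS : u \in S.
  apply: (big_jump_in_partition fc oS) => //; rewrite ju.1 le_Rplus.
  by rewrite (le_trans (_ : Rplus_val u <= Rplus_val s))// (le_trans (ltW sb))// ltW.
by have := hb _ uS; rewrite tu/= lt_Rplus (le_lt_trans _ sb).
Qed.

Lemma big_jumps_left f t e : cadlag f -> 0 < e -> (Rplus0 R < t)%O ->
  exists2 a, (a < t)%O & forall s, (a < s < t)%O ->
    big_jumps f s e = big_jumps f t e `&` [set u | (u < t)%O].
Proof.
move=> fc e0 t0; have [S [_ oS]] := cadlag_osc_partition t fc e0.
have [a at_ ha] := gap_left S t0.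
exists a => // s /andP[as_ st]; apply/seteqP; split => u.
  move=> [ju [us eu]]; split; last exact: le_lt_trans st.
  by split=> //; split => //; rewrite (le_trans us)// ltW.
move=> [[ju [ut eu]] /= utt]; split => //; split => //.
rewrite leNgt; apply/negP => su.
have uS : u \in S by apply: (big_jump_in_partition fc oS) => //; rewrite ju.1.
by have := ha _ uS; rewrite utt (lt_trans as_).
Qed.

(** The criterion by which the paths of a counting process with locally finitely
    many jumps are cadlag. *)
Lemma step_cadlag f :
  (forall t, exists2 b, Rplus_val t < b &
     forall s, Rplus_val t <= Rplus_val s < b -> f s = f t) ->
  (forall t, (Rplus0 R < t)%O -> exists2 a, (a < t)%O &
     exists l, forall s, (a < s < t)%O -> f s = l) -> cadlag f.
Proof.
move=> hr hl; split=> t.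
  apply/right_cvgP => e e0; have [b tb hb] := hr t; exists b => // s /andP[ts sb].
  by rewrite hb ?subrr ?normr0// ltW.
move=> t0; have [a at_ [l hal]] := hl _ t0.
apply/cvg_ex; exists l; apply/left_cvgP => // e e0.
exists (Rplus_val a); first by rewrite Rplus_val_ge0.
by move=> s ats; rewrite hal// subrr normr0.
Qed.

End locally_constant.

Section large_jump_kernel.
Context {d : measure_display} {Omega : measurableType d} {R : realType}.
Variable F : Rplus R -> set_system Omega.
Hypothesis hF : filtration F.
Variable Y : Omega * Rplus R -> R.
Hypothesis hY : adapted_cadlag F Y.
Implicit Types (H : Omega * Rplus R -> R) (w : Omega) (t : Rplus R).

Definition path_mark w (s : Rplus R) : (optionalType F * R)%type :=
  ((w, s), jump (trajectory Y w) s).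

(** The marks live on [Omega * R^+ * R] rather than on [R^+ * R]: the integrand
    of the optional integral then no longer depends on the starting point [p],
    as is required of the integrand in the measurability of kernel integrals.
    The threshold [e = 0] counts all jumps. *)
Definition jump_kernel (e : R) (p : optionalType F) :
    {measure set (optionalType F * R)%type -> \bar R} :=
  image_count (big_jumps (trajectory Y p.1) p.2 e) (path_mark p.1).

Lemma jump_kernelE e p U : jump_kernel e p U =
  ecard (big_jumps (trajectory Y p.1) p.2 e `&` path_mark p.1 @^-1` U).
Proof. by []. Qed.

Lemma jump_kernel_fin_num e p U : 0 < e -> jump_kernel e p U \is a fin_num.
Proof.
move=> e0; rewrite jump_kernelE; apply: ecard_fin_num; apply: finite_setIl.
exact: finite_big_jumps (hY.2 _) e0.
Qed.

(** The cardinality is the limit, as [m] grows, of the jump sums of the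
    functions [cutoff m]; each of these is a limit of Riemann sums, which involve
    the processes at times at most [t] only. *)
Lemma jump_kernel_half_set e t H (c : R) : 0 < e -> adapted_cadlag F H ->
  measurable_fun setT
    ((fun w => jump_kernel e (w, t) (half_set (F := F) H c)) : filtType F t -> \bar R).
Proof.
move=> e0 aH.
have /choice[S hS] : forall w, exists S, uniq S /\ osc_partition (trajectory Y w) t e S.
  by move=> w; exact: cadlag_osc_partition (hY.2 w) e0.
pose J w := jump (trajectory Y w).
pose r w : R := \sum_(s <- S w) [&& 0 < H (w, s), c < J w s & e < `|J w s|]%:R.
have -> : (fun w => jump_kernel e (w, t) (half_set (F := F) H c)) = EFin \o r.
  apply/funext => w; have [uS oS] := hS w; rewrite jump_kernelE.
  apply: (@ecard_in_seq R _ (S w) (fun s => [&& 0 < H (w, s), c < J w s & e < `|J w s|]) _ uS).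
  apply/seteqP; split => s /=.
    move=> [[[s0 js] [st es]] [/= -> cs]]; split; last by rewrite cs es.
    by apply: (big_jump_in_partition (hY.2 w) oS) => //; rewrite s0.
  move=> [/(oS.1)/andP[s0 st] /and3P[Hs cs es]]; split; last by split.
  split => //; split => //; rewrite -normr_gt0; exact: lt_trans es.
apply/measurable_EFinP.
apply: (@measurable_fun_cvg _ (filtType F t) R setT
  (fun m w => \sum_(s <- S w) cutoff m c e (H (w, s)) (J w s))) => [m|w _]; last first.
  by apply: cvg_sum_seq => s _; exact: cvg_cutoff.
apply: (@measurable_fun_cvg _ (filtType F t) R setT
  (fun n w => \sum_(0 <= k < n.+1) cutoff m c e (H (w, grid t n k.+1))
     (Y (w, grid t n k.+1) - Y (w, grid t n k)))) => [n|w _]; last first.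
  have [uS oS] := hS w.
  apply: (riemann_sum_jumps (hY.2 w) (aH.2 w) (ltW e0) uS oS).
    by move=> y x; exact: cutoff0.
  by move=> u v y x; exact: cutoff_cvg.
under eq_fun do rewrite big_mkord.
apply: measurable_sum => k.
have gt k' : (k' <= n.+1)%N -> (grid t n k' <= t)%O.
  by move=> kn; rewrite -[X in (_ <= X)%O](grid_last t n) le_grid.
have mZ Z k' : adapted_cadlag F Z -> (k' <= n.+1)%N ->
    measurable_fun setT ((fun w => Z (w, grid t n k')) : filtType F t -> R).
  move=> [/(adaptedP hF) aZ _] kn; exact: (filt_measurable hF (gt _ kn) (aZ _)).
apply: measurable_cutoff; first by apply: mZ => //; exact: ltn_ord.
by apply: measurable_funB; apply: mZ => //; exact: ltnW.
Qed.

(** Dynkin's theorem; the threshold [e > 0] makes the total mass finite, which is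
    what complements require. *)
Lemma jump_kernel_adapted e t U : 0 < e -> measurable U ->
  measurable_fun setT ((fun w => jump_kernel e (w, t) U) : filtType F t -> \bar R).
Proof.
move=> e0; rewrite (half_generatorE hF).
have mpos H (c : R) : adapted_cadlag F H -> measurable (half_set (F := F) H c).
  exact: measurable_half_set.
have KT : measurable_fun setT
    ((fun w => jump_kernel e (w, t) setT) : filtType F t -> \bar R).
  (* the whole space is the increasing union of the sets [{1 > 0} x {x > - n}] *)
  pose P1 n := half_set (F := F) (fun=> 1) (- n%:R).
  have a1 := adapted_cadlag_cst hF 1.
  apply: (@emeasurable_fun_cvg _ (filtType F t) R setT
    (fun n w => jump_kernel e (w, t) (P1 n))) => [n|w _].
    exact: jump_kernel_half_set.
  have UT : \bigcup_n P1 n = setT.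
    apply/seteqP; split => // y _; exists (Num.truncn `|y.2|).+1 => //; split => //=.
    by rewrite ltrNl (le_lt_trans _ (truncnS_gt _))// -normrN ler_norm.
  rewrite -UT; apply: (@nondecreasing_cvg_mu _ _ R (jump_kernel e (w, t)) P1).
  - by move=> n; exact: mpos.
  - by rewrite UT.
  - move=> m n mn; apply/subsetPset => y [_ /= my]; split => //=.
    by apply: le_lt_trans my; rewrite lerN2 ler_nat.
apply: (dynkin_induction (P := [set U | measurable_fun setT
   ((fun w => jump_kernel e (w, t) U) : filtType F t -> \bar R)])).
- exact: half_generatorE.
- exact: half_generator_setI.
- exact: KT.
- by move=> _ [H [c [aH ->]]]; exact: jump_kernel_half_set.
- move=> S mS /= hS.
  rewrite (_ : (fun w => _) = (fun w => jump_kernel e (w, t) setT - jump_kernel e (w, t) S)%E).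
    exact: emeasurable_funB.
  apply/funext => w; rewrite -[in X in (X - _)%E](setUv S) measureU//.
  + by rewrite [X in (X - _)%E]addeC addeK// jump_kernel_fin_num.
  + exact: measurableC.
  + by rewrite setICr.
- move=> G mG tG /= hG.
  rewrite (_ : (fun w => _) = (fun w => \sum_(n <oo) jump_kernel e (w, t) (G n))%E).
    by apply: ge0_emeasurable_sum => [n w _ _|n _]; [exact: measure_ge0|exact: hG].
  apply/funext => w; apply: measure_semi_bigcup => //.
  by apply: bigcup_measurable => n _; exact: mG.
Qed.

End large_jump_kernel.

(** * Optional measurability of the integrals *)

Section optional_integral.
Context {d : measure_display} {Omega : measurableType d} {R : realType}.
Variable F : Rplus R -> set_system Omega.
Hypothesis hF : filtration F.
Variable Y : Omega * Rplus R -> R.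
Hypothesis hY : adapted_cadlag F Y.

Local Notation jump_kernel := (@jump_kernel _ Omega R F Y).

(** For fixed [w], the kernel is constant in [t] between two jumps larger than
    [e], so it is a cadlag adapted process. *)
Lemma jump_kernel_optional e U : 0 < e -> measurable U ->
  measurable_fun setT (fun p : optionalType F => jump_kernel e p U).
Proof.
move=> e0 mU; pose Z (p : Omega * Rplus R) : R := fine (jump_kernel e p U).
rewrite (_ : (fun p => _) = EFin \o Z); last first.
  by apply/funext => p; rewrite /= fineK// jump_kernel_fin_num.
apply/measurable_EFinP; apply: adapted_cadlag_optional; split.
  apply/(adaptedP hF) => t.
  have := @jump_kernel_adapted _ _ _ _ hF _ hY e t _ e0 mU.
  by apply: measurableT_comp; exact: fine_measurable.
move=> w; apply: step_cadlag => t.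
  have [b tb hb] := big_jumps_right t (hY.2 w) e0; exists b => // s sb.
  by rewrite /trajectory /Z !jump_kernelE hb.
move=> t0; have [a at_ ha] := big_jumps_left (hY.2 w) e0 t0; exists a => //.
exists (fine (ecard (big_jumps (trajectory Y w) t e `&` [set u | (u < t)%O] `&`
  path_mark F Y w @^-1` U))) => s hs.
by rewrite /trajectory /Z jump_kernelE ha.
Qed.

(** A jump of [band n] exceeds [1 / (n + 1)], so each band may be counted with a
    positive threshold. *)
Lemma jump_kernel_bands U p : jump_kernel 0 p U =
  (\sum_(n <oo) jump_kernel n.+1%:R^-1 p (U `&` setT `*` band n))%E.
Proof.
rewrite jump_kernelE.
under eq_eseriesr do rewrite jump_kernelE.
rewrite -ecard_bigcup; last first.
  by move=> m n _ _ [s [[_ [_ [_ sm]]] [_ [_ [_ sn]]]]];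
    apply: (@trivIset_band R m n) => //; exists (jump (trajectory Y p.1) s).
congr ecard; apply/seteqP; split => s.
  move=> [[js [st s0]] Us]; exists (Num.truncn `|jump (trajectory Y p.1) s|^-1) => //.
  by split=> //; split => //; split => //; apply: band_gt => //; exact: js.2.
move=> [n _ [[js [st _]] [Us _]]]; split => //; split => //; split => //.
by rewrite normr_gt0; exact: js.2.
Qed.

Lemma jump_kernel0_optional U : measurable U ->
  measurable_fun setT (fun p : optionalType F => jump_kernel 0 p U).
Proof.
move=> mU; under eq_fun do rewrite jump_kernel_bands.
apply: ge0_emeasurable_sum => [n p _ _|n _]; first exact: measure_ge0.
apply: jump_kernel_optional => //; apply: measurableI => //.
by apply: measurableX => //; exact: measurable_band.
Qed.

(** The kernel is the image of the jump measure restricted to times at most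
    [p.2] under [y |-> ((p.1, y.1), y.2)]. *)
Lemma integral_jump_kernel (W : optionalType F * R -> \bar R) (p : optionalType F) :
  measurable_fun setT W -> (forall y, (0 <= W y)%E) ->
  (\int[image_count (jump_times (trajectory Y p.1)) (mark (trajectory Y p.1))]_(y in
     [set y : Rplus R * R | (y.1 <= p.2)%O]) W ((p.1, y.1), y.2) =
   \int[jump_kernel 0 p]_y W y)%E.
Proof.
move: p => [w t] mW W0 /=; set g := trajectory Y w.
pose D := [set y : Rplus R * R | (y.1 <= t)%O].
pose m_ : {measure set (Rplus R * R)%type -> \bar R} :=
  image_count (jump_times g) (mark g).
pose mt : {measure set (Rplus R * R)%type -> \bar R} :=
  image_count (big_jumps g t 0) (mark g).
pose theta (y : Rplus R * R) : optionalType F * R := ((w, y.1), y.2).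
have mtheta : measurable_fun setT theta.
  apply: measurable_fun_pair; last exact: measurable_snd.
  apply: (measurableT_comp (T2 := Rplus R) (f := fun s => (w, s) : optionalType F)).
    exact: measurable_optional_path.
  exact: measurable_fst.
have mD : measurable D.
  rewrite (_ : D = ((@Rplus_val R) @^-1` `]-oo, Rplus_val t]) `*` setT).
    apply: measurableX => //; rewrite -[X in measurable X]setTI.
    exact: measurable_Rplus_val.
  by apply/seteqP; split => y; rewrite /D/= in_itv/= le_Rplus => // -[].
have mWt : measurable_fun setT (W \o theta) by exact: measurableT_comp.
transitivity (\int[mt]_(y in D) (W \o theta) y)%E.
  apply: (eq_measure_integral mt) => A mA AD /=.
  rewrite /mt /m_ /image_count; congr ecard; apply/seteqP; split => s.
    move=> [js sA]; split => //; split => //; split; first exact: AD _ sA.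
    by rewrite normr_gt0; exact: js.2.
  by move=> [[js _] sA]; split.
transitivity (\int[mt]_y (W \o theta) y)%E.
  rewrite [RHS](ge0_negligible_integral (measurableC mD))//.
  - by rewrite setTD setCK.
  - by move=> y _; exact: W0.
  - rewrite /mt /= /image_count (_ : _ `&` _ = set0) ?ecard0//.
    by apply/seteqP; split => // s [[_ [st _]] /=].
rewrite -[LHS](ge0_integral_pushforward mtheta mt measurableT mW).
  by apply: eq_measure_integral => A mA _.
by move=> y _; exact: W0.
Qed.

Lemma jump_measure_optional (X : Omega * Rplus R -> R) :
  (forall w, jump_measure X w =
    image_count (jump_times (trajectory Y w)) (mark (trajectory Y w))) ->
  optional_measure F (jump_measure X).
Proof.
move=> XY W mW W0.
rewrite (_ : (fun p => _) = (fun p => \int[jump_kernel 0 p]_y W y)%E).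
  exact: measurable_fun_integral_kernel jump_kernel0_optional _ W0 mW.
by apply/funext => p; rewrite XY integral_jump_kernel.
Qed.

End optional_integral.

(** * Predictable sigma-finiteness *)

Section band_counts.
Context {R : realType}.
Implicit Types (f : Rplus R -> R) (t s : Rplus R).

(** The jumps strictly before [t], in contrast with [big_jumps]: this makes their
    number left-continuous in [t]. *)
Definition past_jumps f (n : nat) t : set (Rplus R) :=
  [set u | jump_times f u /\ (u < t)%O /\ band n (jump f u)].

Lemma finite_past_jumps f n t : cadlag f -> finite_set (past_jumps f n t).
Proof.
move=> fc; apply: (@sub_finite_set _ _ (big_jumps f t n.+1%:R^-1)).
  move=> u [ju [ut bu]]; split => //; split; first exact: ltW.
  by apply: band_gt => //; exact: ju.2.
by apply: finite_big_jumps.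
Qed.

Lemma le_past_jumps f n s t : (s <= t)%O -> past_jumps f n s `<=` past_jumps f n t.
Proof. by move=> st u [ju [us bu]]; split=> //; split => //; exact: lt_le_trans st. Qed.

(** Immediately before [t] there is no jump of the band, so that the number of
    past jumps at [t] is already known, both as a number of past jumps and as a
    value of the adapted kernel, at earlier times. *)
Lemma past_jumps_left f n t : cadlag f -> (Rplus0 R < t)%O ->
  exists2 a, (a < t)%O & forall s, (a < s < t)%O ->
    big_jumps f s n.+1%:R^-1 `&` [set u | band n (jump f u)] = past_jumps f n t /\
    past_jumps f n s = past_jumps f n t.
Proof.
move=> fc t0; have e0 : 0 < n.+1%:R^-1 :> R by rewrite invr_gt0.
have [a at_ ha] := big_jumps_left fc e0 t0.
have E s : (a < s < t)%O ->
    big_jumps f s n.+1%:R^-1 `&` [set u | band n (jump f u)] = past_jumps f n t.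
  move=> ast; rewrite ha//; apply/seteqP; split => u.
    by move=> [[[ju [ut eu]] /= utt] bu].
  move=> [ju [ut bu]]; split => //; split => //; split => //; split; first exact: ltW.
  by apply: band_gt => //; exact: ju.2.
exists a => // s /andP[as_ st]; split; first by apply: E; rewrite as_.
apply/seteqP; split; first exact/le_past_jumps/ltW.
pose s' := to_Rplus ((Rplus_val a + Rplus_val s) / 2).
have as' : Rplus_val a < Rplus_val s by [].
have s'E : Rplus_val s' = (Rplus_val a + Rplus_val s) / 2.
  by rewrite to_RplusK// divr_ge0// addr_ge0// Rplus_val_ge0.
have as1 : (a < s')%O by rewrite lt_Rplus s'E; lra.
have s's : (s' < s)%O by rewrite lt_Rplus s'E; lra.
rewrite -(E s'); last by rewrite as1 (lt_trans s's).
by move=> u [[ju [us' _]] bu]; split => //; split => //; exact: le_lt_trans s's.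
Qed.

(** The jump at [s] itself is new: it belongs to the past of [t] but not to the
    past of [s]. *)
Lemma past_jumps_strict f n s t : cadlag f -> (s < t)%O -> jump_times f s ->
  band n (jump f s) -> ecard (past_jumps f n s) != ecard (past_jumps f n t) :> \bar R.
Proof.
move=> fc st js bs; rewrite !ecard_finite; try exact: finite_past_jumps.
apply/eqP => -[/eqP]; rewrite eqr_nat => /eqP card_eq.
have /fsetP/(_ s) : fset_set (past_jumps f n s) = fset_set (past_jumps f n t).
  apply/eqP; rewrite eqEfcard card_eq leqnn andbT.
  apply/fsubsetP => u; rewrite !in_fset_set; try exact: finite_past_jumps.
  by move=> /set_mem /(le_past_jumps (ltW st)) /mem_set.
rewrite !in_fset_set; try exact: finite_past_jumps.
rewrite [RHS]mem_set; last by split.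
by move=> /set_mem[_ []]; rewrite ltxx.
Qed.

(** Order-convex sets of the half-line are traces of intervals of the line. *)
Lemma measurable_is_interval_Rplus (I : set (Rplus R)) :
  (forall a b c, I a -> I c -> (a <= b <= c)%O -> I b) -> measurable I.
Proof.
move=> hI; exists (@Rplus_val R @` I); last first.
  by rewrite setTI; apply/seteqP; split => [t [s Is /Rplus_val_inj <-]//|t It]; exists t.
apply: is_interval_measurable => _ _ [a Ia <-] [c Ic <-] b /andP[ab bc].
have b0 : 0 <= b by rewrite (le_trans _ ab)// Rplus_val_ge0.
exists (to_Rplus b); last by rewrite to_RplusK.
by apply: (hI a _ c) => //; rewrite !le_Rplus to_RplusK// ab.
Qed.

End band_counts.

Section integral_bound.
Import HBNNSimple.

(** The integral of a nonnegative function is the supremum of the integrals of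
    the simple functions below it, and each of these is at most [1]. *)
Lemma ge0_integral_le1 {d} {T : measurableType d} {R : realType}
    (P : probability T R) (f : T -> \bar R) :
  (forall x, 0 <= f x <= 1)%E -> (\int[P]_x f x <= 1)%E.
Proof.
move=> f01; rewrite ge0_integralTE; last by move=> x; have /andP[] := f01 x.
apply: ge_ereal_sup => _ [h /= hf <-].
have <- : (\int[P]_x (cst 1%E) x = 1)%E.
  by rewrite integral_cst// mul1e; exact: probability_setT.
have -> : sintegral P h = (\int[P]_x (h x)%:E)%E.
  by rewrite integral_nnsfun// patch_setT.
apply: ge0_le_integral => //.
- by move=> x _; rewrite lee_fin.
- by apply/measurable_EFinP.
- by move=> x _; apply: le_trans (hf x) _; have /andP[] := f01 x.
Qed.

End integral_bound.

Section predictable.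
Context {d : measure_display} {Omega : measurableType d} {R : realType}.
Variables (P : probability Omega R) (F : Rplus R -> set_system Omega).
Hypothesis hF : filtration F.
Variable Y : Omega * Rplus R -> R.
Hypothesis hY : adapted_cadlag F Y.

Definition past_count (n : nat) (p : Omega * Rplus R) : R :=
  fine (ecard (past_jumps (trajectory Y p.1) n p.2)).

Lemma past_count_nat n p : exists k : nat, past_count n p = k%:R.
Proof. by rewrite /past_count ecard_finite; [eexists|exact: finite_past_jumps (hY.2 _)]. Qed.

Lemma le_past_count n w s t : (s <= t)%O -> past_count n (w, s) <= past_count n (w, t).
Proof.
move=> st; apply: fine_le; rewrite ?ecard_fin_num//; try exact: finite_past_jumps (hY.2 _).
exact/le_ecard/le_past_jumps.
Qed.

Lemma past_count_left_continuous n w : left_continuous (trajectory (past_count n) w).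
Proof.
move=> t t0; apply/left_cvgP => // e e0.
have [a at_ ha] := past_jumps_left n (hY.2 w) t0.
exists (Rplus_val a); first by rewrite Rplus_val_ge0.
move=> s /ha[_ E]; rewrite /trajectory /past_count/= E subrr normr0//.
Qed.

Lemma past_count_adapted n : adapted F (past_count n).
Proof.
apply/(adaptedP hF) => t.
have [->|/gt0_Rplus t0] := eqVneq t (Rplus0 R).
  rewrite (_ : (fun w => _) = cst 0); first exact: measurable_cst.
  apply/funext => w; rewrite /past_count (_ : past_jumps _ _ _ = set0) ?ecard0//.
  apply/seteqP; split => // u [_ [/=]].
  by rewrite lt_Rplus Rplus_val0 ltNge Rplus_val_ge0.
have [u [ut cu]] := seq_to_left t0.
pose B : set (optionalType F * R) := setT `*` band n.
have mB : measurable B by apply: measurableX => //; exact: measurable_band.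
pose Z (k : nat) (w : Omega) : R := fine (jump_kernel Y n.+1%:R^-1 ((w, u k) : optionalType F) B).
apply: (@measurable_fun_cvg _ (filtType F t) R setT Z) => [k|w _].
  apply: (filt_measurable hF (ltW (ut k))).
  have e0 : 0 < n.+1%:R^-1 :> R by rewrite invr_gt0.
  have := @jump_kernel_adapted _ _ _ _ hF _ hY _ (u k) _ e0 mB.
  by apply: measurableT_comp; exact: fine_measurable.
have [a at_ ha] := past_jumps_left n (hY.2 w) t0.
apply: (@cvg_trans _ (cst (past_count n (w, t)) @ \oo)); last exact: cvg_cst.
apply: near_eq_cvg; near=> k.
have /ha[E _] : (a < u k < t)%O.
  rewrite ut andbT lt_Rplus; near: k.
  by apply: cvgr_gt cu _ _.
rewrite /Z jump_kernelE /past_count /= -E; congr (fine (ecard _)).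
by apply/seteqP; split => s [js]; [split|case].
Unshelve. all: by end_near. Qed.

(** A predictable set isolating, along each path, the jump of [band n] that has
    exactly [k] predecessors in this band. *)
Definition layer (n k : nat) : set (predictableType F * R) :=
  (past_count n @^-1` [set k%:R]) `*` band n.

Lemma measurable_layer n k : measurable (layer n k).
Proof.
apply: measurableX; last exact: measurable_band.
apply: sub_sigma_algebra; exists (past_count n); split.
- exact: past_count_adapted.
- exact: past_count_left_continuous.
- by exists [set k%:R].
Qed.

(** Two jumps of the band cannot have the same number of predecessors. *)
Lemma layer_mass n k w : 
  (\int[image_count (jump_times (trajectory Y w)) (mark (trajectory Y w))]_y
     (\1_(layer n k) ((w, y.1), y.2) : R)%:E <= 1)%E.
Proof.
set g := trajectory Y w.
pose L : set (Rplus R * R) := [set s | past_count n (w, s) = k%:R] `*` band n.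
have mL : measurable L.
  apply: measurableX; last exact: measurable_band.
  apply: measurable_is_interval_Rplus => a b c /= ak ck /andP[ab bc].
  apply/eqP; rewrite eq_le -{1}ck -ak; apply/andP; split; exact: le_past_count.
rewrite (_ : (fun y => _) = (fun y => (\1_L y)%:E)); last by apply/funext => -[s x].
rewrite integral_indic// setIT /= /image_count.
apply: ecard_subset1 => s t.
move=> [js [/= sk bs]] [jt [/= tk bt]].
have neq s' t' : (s' < t')%O -> jump_times g s' -> band n (jump g s') ->
    past_count n (w, s') = k%:R -> past_count n (w, t') = k%:R -> False.
  move=> st js' bs' sk' tk'; have /eqP := past_jumps_strict (hY.2 w) st js' bs'; apply.
  rewrite -(fineK (ecard_fin_num (finite_past_jumps n s' (hY.2 w)))).
  rewrite -(fineK (ecard_fin_num (finite_past_jumps n t' (hY.2 w)))).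
  by congr EFin; rewrite -/(past_count n (w, s')) -/(past_count n (w, t')) sk' tk'.
have [st|ts|//] := ltgtP s t; exfalso.
  exact: neq st js bs sk tk.
exact: neq ts jt bt tk sk.
Qed.

Definition layer_seq (m : nat) : set (predictableType F * R) :=
  if pickle_inv m is Some nk then layer nk.1 nk.2 else set0.

Lemma jump_measure_predictable (X : Omega * Rplus R -> R) :
  (forall w, jump_measure X w =
    image_count (jump_times (trajectory Y w)) (mark (trajectory Y w))) ->
  predictable_sigma_finite P F (jump_measure X).
Proof.
move=> XY; exists layer_seq; split.
- move=> m; rewrite /layer_seq; case: pickle_inv => [[n k]|//].
  exact: measurable_layer.
- move=> m m' _ _ [y []]; rewrite /layer_seq.
  have := @pickle_invK (nat * nat)%type m; have := @pickle_invK (nat * nat)%type m'.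
  case: (pickle_inv m) => [[n k]|//]; case: (pickle_inv m') => [[n' k']|//] /=.
  move=> <- <- [/= ck bn] [/= ck' bn'].
  have nn : n = n' by rewrite -bn -bn'.
  by move: ck'; rewrite -nn ck => /eqP; rewrite eqr_nat => /eqP ->.
- apply/seteqP; split => // y _.
  have [k hk] := past_count_nat (Num.truncn `|y.2|^-1) y.1.
  exists (choice.pickle (Num.truncn `|y.2|^-1, k)) => //.
  by rewrite /layer_seq pickleK_inv.
- move=> m; apply: (@le_lt_trans _ _ 1%E); last exact: ltry.
  apply: ge0_integral_le1 => w; rewrite XY; apply/andP; split.
    by apply: integral_ge0 => y _; rewrite lee_fin.
  rewrite /layer_seq; case: pickle_inv => [[n k]|]; first exact: layer_mass.
  by rewrite integral0_eq ?lee01// => y _; rewrite indic0.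
Qed.

End predictable.

(** * The jump measure *)

Section reduction_to_cadlag.
Context {d : measure_display} {Omega : measurableType d} {R : realType}.
Implicit Types X : Omega * Rplus R -> R.

Lemma jump_measure_regularization X w : regulated (trajectory X w) ->
  jump_measure X w = image_count (jump_times (trajectory (regularization X) w))
    (mark (trajectory (regularization X) w)).
Proof.
move=> rX; rewrite jump_measureE.
have E : jump (trajectory (regularization X) w) = jump (trajectory X w).
  by apply/funext => t; exact: jump_regularization.
by rewrite /jump_times /mark E.
Qed.

End reduction_to_cadlag.

Theorem theorem5 (R : realType) (d : measure_display) (Omega : measurableType d)
    (P : probability Omega R) (F : Rplus R -> set_system Omega)
    (hF : filtration F) (hPF : usual_conditions P F)
    (X : Omega * Rplus R -> R)
    (hX : optional_process F X)
    (hreg : forall w, regulated (trajectory X w))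
    (hX0 : forall w, jump (trajectory X w) (Rplus0 R) = 0)
    (hinf : forall w, infinite_set (jump_times (trajectory X w))) :
  integer_valued_random_measure P F (jump_measure X).
Proof.
have hY := regularization_adapted_cadlag hF hX hPF.1 hreg.
have XY w := jump_measure_regularization (hreg w).
split.
- move=> w; split; first by exists (image_count (jump_times (trajectory X w))
    (mark (trajectory X w))) => G _; rewrite jump_measureE.
  rewrite jump_measureE /image_count (_ : _ `&` _ = set0) ?ecard0//.
  by apply/seteqP; split => // s [[s0 _] [/= s00 _]]; rewrite s00 ltxx in s0.
- move=> w t; rewrite jump_measureE; apply: ecard_subset1 => s u.
  by move=> [_ [/= -> _]] [_ [/= -> _]].
- by move=> w G _; rewrite jump_measureE; exact: ecard_integer.
- exact: jump_measure_optional hF _ hY _ XY.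
- exact: jump_measure_predictable P _ hF _ hY _ XY.
Qed.
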